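(* Let $G$ be a virtually $\mathbb{Z}$ group and let $\alpha: G\curvearrowright X$ be a minimal topologically free action of $G$ on an infinite compact metrizable space $X$ such that $\alpha$ has the small boundary property. Then $\alpha$ is almost finite.
   Context: All actions are by homeomorphisms. A group is virtually $\mathbb{Z}$ if it has a finite-index subgroup isomorphic to $\mathbb{Z}$. An action is minimal if all orbits are dense; it is topologically free if for every $s\neq e$ the fixed point set $\{x\in X: sx=x\}$ is nowhere dense. $M_G(X)$ is the set of $G$-invariant Borel probability measures on $X$. The action has the small boundary property if for every $x\in X$ and open $U\ni x$ there is an open set $V$ with $x\in V\subset U$ and $\mu(\partial V)=0$ for all $\mu\in M_G(X)$. Fix a compatible metric on $X$. For finite $K\subset G$ and $\epsilon>0$, a finite set $S\subset G$ is $(K,\epsilon)$-F{\o}lner if $|KS\setminus S|<\epsilon|S|$. A tower is a pair $(S,B)$ with $S\subset G$ finite and $B\subset X$ such that the sets $sB$, $s\in S$, are pairwise disjoint; $S$ is its shape and $B$ its base. A castle is a finite family of towers $\{(S_i,B_i): i\in I\}$ such that $sB_i\cap tB_j=\emptyset$ for all $s\in S_i$, $t\in S_j$, $i\neq j$; it is open if all $B_i$ are open. For a closed set $C$ and an open set $O$, write $C\prec O$ if there are open sets $V_1,\dots,V_m$ and $s_1,\dots,s_m\in G$ with $C\subset\bigcup_i V_i$, the sets $s_iV_i$ pairwise disjoint, and $\bigsqcup_i s_iV_i\subset O$. An action of a countable amenable group $G$ on a compact metrizable space $X$ is almost finite if for every finite $K\subset G$, integer $n\geq 1$ and $\epsilon>0$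 there is an open castle $\{(S_i,B_i): i\in I\}$ such that (i) each $S_i$ is $(K,\epsilon)$-F{\o}lner; (ii) $\operatorname{diam}(sB_i)<\epsilon$ for all $s\in S_i$, $i\in I$; (iii) for each $i\in I$ there is $S_i'\subset S_i$ with $|S_i'|<\frac1n|S_i|$ such that $X\setminus\bigsqcup_{i\in I}S_iB_i\prec\bigsqcup_{i\in I}S_i'B_i$. *)

(* Defs.v *)
From HB Require Import structures.
From mathcomp Require Import all_boot all_order all_algebra finmap.
From mathcomp Require Import all_classical all_reals all_analysis.

Set Implicit Arguments.
Unset Strict Implicit.
Unset Printing Implicit Defensive.

Import Order.TTheory GRing.Theory Num.Theory.

Local Open Scope classical_set_scope.
Local Open Scope ring_scope.

(* A metric space with a distinguished point: the library builds a
   measurableType from generators only on a pointedType. *)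
#[short(type="pmetricType")]
HB.structure Definition PointedMetric (K : numDomainType) :=
  {M of Pointed M & Metric K M}.

Section groups.
Variable G : groupType.

Definition left_coset (H : set G) (g : G) : set G := [set (g * h)%g | h in H].

Definition finite_index (H : set G) : Prop := finite_set (range (left_coset H)).

Definition iso_Z (H : set G) : Prop :=
  exists f : int -> G,
    [/\ {morph f : m n / m + n >-> (m * n)%g}, injective f & range f = H].

Definition virtually_Z : Prop :=
  exists H : groupClosed G, finite_index [set` H] /\ iso_Z [set` H].

End groups.

Definition homeomorphism (X Y : topologicalType) (f : X -> Y) : Prop :=
  continuous f /\
  exists g : Y -> X, [/\ continuous g, cancel f g & cancel g f].

Definition action_by_homeo (G : groupType) (X : topologicalType)
    (act : G -> X -> X) : Prop :=
  [/\ forall x, act 1%g x = x,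
      forall g h x, act (g * h)%g x = act g (act h x)
    & forall g, homeomorphism (act g)].

Definition minimal_action (G : groupType) (X : topologicalType)
    (act : G -> X -> X) : Prop :=
  forall x, dense (range (act^~ x)).

Definition nowhere_dense (X : topologicalType) (A : set X) : Prop :=
  (closure A)° = set0.

Definition topologically_free (G : groupType) (X : topologicalType)
    (act : G -> X -> X) : Prop :=
  forall s : G, s != 1%g -> nowhere_dense [set x | act s x = x].

Definition boundary (X : topologicalType) (A : set X) : set X :=
  closure A `\` A°.

Definition borel (X : ptopologicalType) := g_sigma_algebraType (@open X).

Section actions.
Variables (R : realType) (G : groupType) (X : pmetricType R).
Variable act : G -> X -> X.

Definition invariant_probability (mu : probability (borel X) R) : Prop :=
  forall (g : G) (A : set (borel X)),
    measurable A -> mu (act g @^-1` A) = mu A.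

Definition small_boundary_property : Prop :=
  forall (x : X) (U : set X), open U -> U x ->
  exists V : set X, [/\ open V, V x, V `<=` U
    & forall mu : probability (borel X) R,
        invariant_probability mu -> mu (boundary V) = 0%E].

(* The diameter of the empty set is -oo; diameters are only compared with
   positive reals. *)
Definition diam (A : set X) : \bar R :=
  ereal_sup [set (mdist z.1 z.2)%:E | z in A `*` A].

Definition folner (K : {fset G}) (eps : R) (S : {fset G}) : Prop :=
  #|` ([fset (k * s)%g | k in K, s in S] `\` S)%fset|%:R < eps * #|` S|%:R.

Definition tower (S : {fset G}) (B : set X) : Prop :=
  trivIset [set` S] (fun s => act s @` B).

Definition castle (I : finType) (S : I -> {fset G}) (B : I -> set X) : Prop :=
  (forall i, tower (S i) (B i)) /\
  (forall i j s t, i != j -> s \in S i -> t \in S j ->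
     (act s @` B i) `&` (act t @` B j) = set0).

Definition open_castle (I : finType) (S : I -> {fset G}) (B : I -> set X) :
    Prop :=
  castle S B /\ forall i, open (B i).

Definition levels (I : finType) (S : I -> {fset G}) (B : I -> set X) : set X :=
  \bigcup_(i in [set: I]) \bigcup_(s in [set` S i]) act s @` B i.

(* Only applied to C closed and O open; m = 0 is harmless, since an empty V_i
   can always be added. *)
Definition dyn_subequiv (C O : set X) : Prop :=
  exists (m : nat) (V : 'I_m -> set X) (s : 'I_m -> G),
    [/\ forall i, open (V i),
        C `<=` \bigcup_(i in [set: 'I_m]) V i,
        trivIset [set: 'I_m] (fun i => act (s i) @` V i)
      & \bigcup_(i in [set: 'I_m]) act (s i) @` V i `<=` O].

Definition almost_finite : Prop :=
  forall (K : {fset G}) (n : nat) (eps : R), (1 <= n)%N -> 0 < eps ->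
  exists (I : finType) (S : I -> {fset G}) (B : I -> set X),
    [/\ open_castle S B,
        forall i, folner K eps (S i),
        forall i s, s \in S i -> (diam (act s @` B i) < eps%:E)%E
      & exists S' : I -> {fset G},
          (forall i, (S' i `<=` S i)%fset /\
             #|` S' i|%:R < n%:R^-1 * #|` S i|%:R :> R) /\
          dyn_subequiv (~` levels S B) (levels S' B)].

End actions.

(* Main.v *)
Require Import Defs.
From HB Require Import structures.
From mathcomp Require Import all_boot all_order all_algebra finmap.
From mathcomp Require Import all_classical all_reals all_analysis.
From mathcomp Require Import ring lra.
From mathcomp Require Import zify.

Set Implicit Arguments.
Unset Strict Implicit.
Unset Printing Implicit Defensive.

Import Order.TTheory GRing.Theory Num.Theory.
Import numFieldNormedType.Exports.

Local Open Scope classical_set_scope.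
Local Open Scope ring_scope.

(** After passing to a power of the generator b of an infinite cyclic
    subgroup of finite index, every element of the group conjugates b to b
    or to its inverse, so the group is a finite union of strands r <b> whose
    position coordinate (the height) behaves almost like a word metric on a
    line ([strands_exist]).

    To build the castle, let V be a small open set with null boundary around
    a point that no short group element fixes. Enumerate the group
    injectively so that smaller heights come first, and attach to each point
    x the first g in this order with g^-1 x in V. This is a Voronoi
    decomposition along every orbit in which the enumeration breaks all
    ties, and it breaks them equivariantly. The levels of the castle are the
    sets on which the attached element is g, cut along the finitely many
    possible cells and along small sets with null boundary. Two levels
    cannot meet, because the attached element is unique, even at points with
    nontrivial stabiliser. Since the visits to V along an orbit are far
    apart, a cell is nearly a long interval in every strand, hence Foelner
    ([voronoi_folner]). What the levels miss lies in finitely many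
    translates of boundaries, a closed set C that is null for every
    invariant measure ([castle_null_remainder]).

    As to the remainder, it suffices to see that a closed null set C is
    dynamically below every nonempty open set O ([null_subequiv]). By weak
    compactness of invariant measures there is a continuous w, equal to 1 on
    C, whose averages along long b-orbit segments are uniformly as small as
    desired ([invariant_null_average]); the measure that would contradict
    this is obtained from an ultralimit of empirical averages, which is
    finitely additive and is turned into a Borel measure by inner and then
    outer regularity ([content_regularisation]). Minimality gives a
    continuous v supported on points that can be moved into O, with averages
    bounded below. Along a b-orbit read w as work arriving at a
    first-in-first-out queue and v as the capacity of the server. The
    backlog is a continuous function of the point, because the arrivals are
    outweighed over a bounded look-back. Work arriving at C is big compared
    with the capacity of a single step, so some step is devoted entirely to
    it, and this step is the target of the point. Distinct points of an
    orbit have disjoint service intervals, so targets never collide, and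
    being strictly inside a service interval is an open condition. The open
    sets so obtained may overlap: a point lying in several of them simply
    owns several targets ([fifo_matching]). *)

(** * Coordinates on a virtually cyclic group *)

Section groups.
Variable G : groupType.

(** The coordinates [g = rep g * zpow (height g)] on a virtually cyclic
    group: the coset representative names a strand and the height a position
    on it. The condition [zpow_conj] makes right multiplication compatible
    with heights up to orientation and a bounded error. *)
Record strands := Strands {
  zpow : int -> G;
  zpowD : {morph zpow : m n / m + n >-> (m * n)%g};
  zpow_conj : forall g, (forall k, (g * zpow k * g^-1)%g = zpow k) \/
                        (forall k, (g * zpow k * g^-1)%g = zpow (- k));
  reps : seq G;
  reps_uniq : uniq reps;
  rep : G -> G;
  height : G -> int;
  rep_height : forall g, g = (rep g * zpow (height g))%g;
  rep_mem : forall g, rep g \in reps;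
  rep_id : forall r, r \in reps -> rep r = r;
  rep_zpow : forall g k, rep (g * zpow k)%g = rep g;
  height_zpow : forall g k, height (g * zpow k)%g = height g + k }.

Lemma coset_pigeonhole (H : groupClosed G) (u : nat -> G) :
  finite_index [set` H] -> exists i j, (i < j)%N /\ ((u i)^-1 * u j)%g \in H.
Proof.
move=> fin; apply: contrapT => none.
have inj : injective (fun i => left_coset [set` H] (u i)).
  move=> i j e.
  have H1 k l : left_coset [set` H] (u k) = left_coset [set` H] (u l) ->
      ((u k)^-1 * u l)%g \in H.
    move=> E; have : left_coset [set` H] (u l) (u l).
      by exists 1%g; [exact: gpred1|rewrite mulg1].
    by rewrite -E => -[h hH <-]; rewrite mulKg.
  have [ij|ji|//] := ltngtP i j.
  - by case: none; exists i, j; split=> //; exact: H1.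
  - by case: none; exists j, i; split=> //; exact: H1.
have : finite_set (setT : set nat).
  have := @finite_preimage _ _ (range (left_coset [set` H]))
    (fun i => left_coset [set` H] (u i)) (in2W inj) fin.
  by apply: sub_finite_set => i _ /=; exists (u i).
exact: infinite_nat.
Qed.

Section conj_powers.
Variables (f : int -> G).
Hypotheses (fD : {morph f : m n / m + n >-> (m * n)%g}) (f_inj : injective f).

Lemma morph0 : f 0 = 1%g.
Proof. by apply: (@mulgI _ (f 0)); rewrite -fD addr0 mulg1. Qed.

Lemma morphN k : f (- k) = (f k)^-1%g.
Proof. by apply/esym/mulg1_eq; rewrite -fD subrr morph0. Qed.

Lemma morphX k (n : nat) : f (k * n%:Z) = (f k ^+ n)%g.
Proof.
elim: n => [|n IH]; first by rewrite mulr0 morph0.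
by rewrite intS mulrDr mulr1 fD IH expgS.
Qed.

Lemma conj_morphM g m j : (f m ^ g)%g = f j ->
  forall k : int, (f (m * k) ^ g)%g = f (j * k).
Proof.
move=> E; case=> n; first by rewrite !morphX conjXg E.
by rewrite NegzE !mulrN !morphN conjVg !morphX conjXg E.
Qed.

(** A conjugation cannot change the scale: its [n]-th iterate is conjugation
    by an element of the cyclic group, hence trivial there, and [m ^+ n = j
    ^+ n]. *)
Lemma conj_sign g (m j t : int) (n : nat) : (0 < n)%N -> m != 0 ->
  (f m ^ g)%g = f j -> (g ^+ n)%g = f t -> j = m \/ j = - m.
Proof.
move=> n0 m0 E gn.
have step i : (i <= n)%N ->
  (f (m ^+ n) ^ (g ^+ i))%g = f (m ^+ (n - i) * j ^+ i).
  elim: i => [|i IH] lin; first by rewrite conjg1 subn0 expr0 mulr1.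
  rewrite expgSr conjgM IH 1?ltnW // -subSS subSn // exprS -mulrA.
  rewrite (conj_morphM E).
  by rewrite exprS mulrCA.
have := step n (leqnn _); rewrite subnn mul1r gn => e.
have : m ^+ n = j ^+ n.
  apply: f_inj; rewrite -e conjgE -!fD -morphN -!fD; congr f.
  by rewrite addrCA addNr addr0.
move/(congr1 (fun z : int => `|z|)); rewrite !normrX => /eqP.
rewrite eqrXn2 ?normr_ge0 // eqr_norm2.
by case/orP => /eqP ->; [left|right]; rewrite ?opprK.
Qed.

End conj_powers.

Lemma conj_sign_exists (H : groupClosed G) (f : int -> G) g :
  finite_index [set` H] -> {morph f : m n / m + n >-> (m * n)%g} ->
  injective f -> range f = [set` H] ->
  exists2 m : int, m != 0 & (f m ^ g)%g = f m \/ (f m ^ g)%g = f (- m)%R.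
Proof.
move=> fin fD fI fH.
have fP h : h \in H -> exists k, h = f k.
  by move=> hH; have : [set` H] h by []; rewrite -fH => -[k _ <-]; exists k.
have [i [j [ij]]] := coset_pigeonhole (fun i => (f i * g)%g) fin.
rewrite invgM -mulgA -(morphN fD) (mulgA (f _)) -fD addrC -conjgE.
move=> /fP[j1 e1].
have [a [c [ac]]] := coset_pigeonhole (fun i => (g ^+ i)%g) fin.
move=> /fP[t]; rewrite -{1}(subnKC (ltnW ac)) expgnDr mulKg => e2.
exists (j%:Z - i%:Z); first by rewrite subr_eq0 eqz_nat gtn_eqF.
rewrite e1.
have := @conj_sign f fD fI g (j%:Z - i%:Z) j1 t (c - a)%N _ _ e1 e2.
rewrite subn_gt0 subr_eq0 eqz_nat gtn_eqF // => /(_ ac isT).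
by move=> [->|->]; [left|right].
Qed.

Lemma finite_index_reps (H : groupClosed G) : finite_index [set` H] ->
  exists s : seq G, forall g, exists2 r, r \in s & (r^-1 * g)%g \in H.
Proof.
move=> /finite_seqP[s sE]; exists (map (xget 1%g) s) => g.
have gs : left_coset [set` H] g \in s.
  by have : [set` s] (left_coset [set` H] g); [rewrite -sE; exists g|].
exists (xget 1%g (left_coset [set` H] g)); first exact: map_f.
case: xgetP => [_ _ [h hH <-]|/(_ g)[]]; first by rewrite invgM mulgVK gpredV.
by exists 1%g; [exact: gpred1|rewrite mulg1].
Qed.

(** The product of the exponents obtained for the finitely many coset
    representatives works for all elements, since elements of the cyclic
    group itself act trivially. *)
Lemma normalised_power : virtually_Z G ->
  exists f : int -> G, [/\ {morph f : m n / m + n >-> (m * n)%g}, injective f,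
    exists M : int, M != 0 /\ forall g,
      (forall k, (f (M * k)%R ^ g)%g = f (M * k)) \/
      (forall k, (f (M * k)%R ^ g)%g = f (M * - k)) &
    exists s : seq G, forall g, exists2 r, r \in s & exists t, g = (r * f t)%g].
Proof.
move=> [H [fin [f [fD fI fH]]]]; exists f.
have [s sP] := finite_index_reps fin.
have fP h : h \in H -> exists k, h = f k.
  by move=> hH; have : [set` H] h by []; rewrite -fH => -[k _ <-]; exists k.
have sP' g : exists2 r, r \in s & exists t, g = (r * f t)%g.
  have [r rs /fP[t tE]] := sP g; exists r => //; exists t.
  by rewrite -tE mulVKg.
split=> //; last by exists s.
have /choice[m mP] g : exists m : int, m != 0 /\
    ((f m ^ g)%g = f m \/ (f m ^ g)%g = f (- m)%R).
  by have [m m0 mE] := conj_sign_exists g fin fD fI fH; exists m.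
exists (\prod_(r <- s) m r); split.
  by rewrite prodf_seq_neq0; apply/allP => r _; case: (mP r).
move=> g; have [r rs [t ->]] := sP' g.
have fixt k : (f k ^ f t)%g = f k.
  by rewrite conjgE -!fD -morphN -?fD // addrCA addNr addr0.
rewrite (big_rem r rs) /=; set q := \prod_(_ <- _) _.
have [_ [e|e]] := mP r; [left|right] => k;
  rewrite -!mulrA conjgM (conj_morphM fD e) fixt //.
by rewrite mulNr mulrN mulrN.
Qed.

Lemma strands_exist : virtually_Z G -> inhabited strands.
Proof.
move=> /normalised_power[f [fD fI [M [M0 MP]] [s sP]]].
pose z k := f (M * k).
have zD : {morph z : m n / m + n >-> (m * n)%g}.
  by move=> a b; rewrite /z mulrDr fD.
have zI : injective z by move=> a b /fI; exact: mulfI.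
pose cz g := [set (g * z k)%g | k in [set: int]].
have czz g k : cz (g * z k)%g = cz g.
  apply/seteqP; split=> _ [l _ <-].
    by exists (k + l) => //; rewrite zD mulgA.
  by exists (l - k) => //; rewrite -mulgA -zD addrC subrK.
pose rp g := xget 1%g (cz g).
have rpP g : exists k, g = (rp g * z k)%g.
  rewrite /rp; case: xgetP => [_ _ [k _ <-]|/(_ g)[]].
    by exists (- k); rewrite -mulgA -zD subrr /z mulr0 morph0 // mulg1.
  by exists 0 => //; rewrite /z mulr0 morph0 // mulg1.
have [ht htP] := choice rpP.
have rpz g k : rp (g * z k)%g = rp g by rewrite /rp czz.
have rprp g : rp (rp g) = rp g by rewrite [in RHS](htP g) rpz.
have htz g k : ht (g * z k)%g = ht g + k.
  apply: zI; apply: (@mulgI _ (rp g)); rewrite zD mulgA -htP.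
  by rewrite -{1}(rpz g k) -htP.
pose rs := undup [seq rp (r * f l%:Z)%g | r <- s, l <- iota 0 `|M|].
apply: inhabits.
apply: (@Strands z zD _ rs (undup_uniq _) rp ht htP _ _ rpz htz).
- move=> g; have [e|e] := MP (g^-1)%g; [left|right] => k; have := e k;
    by rewrite conjgE invgK mulgA.
- move=> g; rewrite mem_undup; have [r rin [t ->]] := sP g.
  apply/allpairsP; exists (r, absz (t %% M)%Z) => /=; split=> //.
    rewrite mem_iota /= add0n -ltz_nat abszE ger0_norm ?modz_ge0 //.
    by rewrite ltz_mod.
  rewrite abszE ger0_norm ?modz_ge0 // {1}(divz_eq t M) addrC fD mulgA mulrC.
  exact: rpz.
- by move=> r; rewrite mem_undup => /allpairsP[[r' l] [_ _ ->]].
Qed.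

End groups.

(** * Topological preliminaries *)

Lemma closed_setD (X : topologicalType) (K U : set X) :
  closed K -> open U -> closed (K `\` U).
Proof.
by move=> cK oU; rewrite setDE; apply: closedI => //; exact: open_closedC.
Qed.

Lemma open_setD (X : topologicalType) (U K : set X) :
  open U -> closed K -> open (U `\` K).
Proof.
by move=> oU cK; rewrite setDE; apply: openI => //; exact: closed_openC.
Qed.

Lemma finite_subcover (X : ptopologicalType) (I : choiceType) (f : I -> set X) :
  compact [set: X] -> (forall i, open (f i)) -> (forall x, exists i, f i x) ->
  exists D : {fset I}, forall x, exists2 i, i \in D & f i x.
Proof.
rewrite compact_cover => X_compact of_ cov.
have [x _|D _ DX] := X_compact I setT f (fun i _ => of_ i).
  by have [i fx] := cov x; exists i.
by exists D => x; have [i iD fx] := DX x Logic.I; exists i.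
Qed.

Lemma fset_near (T : choiceType) (X : topologicalType) (D : {fset T})
    (P : T -> set X) (x : X) :
  (forall i, i \in D -> \forall y \near x, P i y) ->
  \forall y \near x, forall i, i \in D -> P i y.
Proof.
move=> H; apply: (@filterS _ _ _ [set y | forall i : D, P (val i) y]).
  by move=> y Py i iD; exact: (Py [` iD]%fset).
by apply: filter_forall => i; apply: H; exact: fsvalP.
Qed.

(** This lets a sequence of radii stand for all neighbourhoods of a compact
    set. *)
Lemma compact_nbhd_ball (R : realType) (X : pseudoMetricType R) (C U : set X) :
  compact C -> open U -> C `<=` U ->
  \forall k \near \oo, \bigcup_(c in C) ball c (k.+1%:R^-1) `<=` U.
Proof.
move=> /compact_near_coveringP cC oU CU.
have := cC nat \oo (fun k x => ball x (k.+1%:R^-1) `<=` U) _ _.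
have -> : (\forall k \near \oo, \bigcup_(c in C) ball c k.+1%:R^-1 `<=` U) =
    (\forall k \near \oo, C `<=` (fun x => ball x k.+1%:R^-1 `<=` U)).
  apply/propext; split; apply: filterS => k H.
    by move=> x Cx y xy; apply: H; exists x.
  by move=> y [c Cc cy]; exact: (H c).
apply => c /CU Uc.
have /nbhs_ballP[e /= e0 eU] : nbhs c U by exact: open_nbhs_nbhs.
have e20 : 0 < e / 2 by rewrite divr_gt0.
exists (ball c (e / 2), [set k | k.+1%:R^-1 < e / 2]).
  split; first exact: nbhsx_ballx.
  by have := near_infty_natSinv_lt (PosNum e20).
move=> [x k] /= [cx ke] y xy; apply: eU.
rewrite [e]splitr; apply: ball_triangle cx _.
by apply: le_ball xy; exact: ltW.
Qed.

Lemma closed_boundary (X : topologicalType) (U : set X) : closed (boundary U).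
Proof. by apply: closed_setD; [exact: closed_closure|exact: open_interior]. Qed.

Section borel.
Variable X : ptopologicalType.

Lemma open_borel (U : set X) : open U -> measurable (U : set (borel X)).
Proof. by move=> oU; exact: sub_sigma_algebra. Qed.

Lemma closed_borel (C : set X) : closed C -> measurable (C : set (borel X)).
Proof.
move=> cC; rewrite -[C]setCK; apply: (@measurableC _ (borel X)).
by apply: open_borel; exact: closed_openC.
Qed.

Lemma preimage_borel (f : X -> X) (A : set (borel X)) :
  continuous f -> measurable A -> measurable (f @^-1` A : set (borel X)).
Proof.
move=> cf mA.
have mf : measurable_fun setT (f : borel X -> borel X).
  apply: (@measurability _ _ (borel X) (borel X) setT f open) => //.
  move=> _ [U oU <-]; rewrite setTI; apply: open_borel.
  by apply: open_comp => // x _; exact: cf.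
by have := mf measurableT _ mA; rewrite setTI.
Qed.

End borel.

(** * Actions by homeomorphisms *)

Section actions.
Variables (G : groupType) (X : topologicalType) (act : G -> X -> X).
Hypothesis act_homeo : action_by_homeo act.

Lemma act1 x : act 1%g x = x. Proof. by case: act_homeo. Qed.

Lemma actM g h x : act (g * h)%g x = act g (act h x).
Proof. by case: act_homeo. Qed.

Lemma actK g : cancel (act g) (act g^-1%g).
Proof. by move=> x; rewrite -actM mulVg act1. Qed.

Lemma actKV g : cancel (act g^-1%g) (act g).
Proof. by move=> x; rewrite -actM mulgV act1. Qed.

Lemma act_inj g : injective (act g).
Proof. exact: can_inj (actK g). Qed.

Lemma act_continuous g : continuous (act g).
Proof. by case: act_homeo => _ _ /(_ g)[]. Qed.

Lemma open_act_preimage g (U : set X) : open U -> open (act g @^-1` U).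
Proof. by move=> oU; apply: open_comp => // x _; exact: act_continuous. Qed.

Lemma open_act_image g (U : set X) : open U -> open (act g @` U).
Proof.
move=> oU; have -> : act g @` U = act g^-1%g @^-1` U.
  apply/seteqP; split=> [_ [y Uy <-]|y Uy] /=; first by rewrite actK.
  by exists (act g^-1%g y) => //; rewrite actKV.
exact: open_act_preimage.
Qed.

Lemma iter_zpow (sd : strands G) j x :
  iter j (act (zpow sd 1)) x = act (zpow sd j%:Z) x.
Proof.
elim: j => [|j IH]; first by rewrite /= (morph0 (zpowD sd)) act1.
by rewrite iterS IH -actM -(zpowD sd) intS.
Qed.

Lemma orbit_meets (U : set X) x : minimal_action act ->
  open U -> U !=set0 -> exists g, U (act g x).
Proof.
move=> act_min oU U0; have [y [Uy [g _ gy]]] := act_min x U U0 oU.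
by exists g; rewrite gy.
Qed.

Lemma near_off_boundary (U : set X) g y : ~ boundary U (act g y) ->
  \forall y' \near y, U (act g y') <-> U (act g y).
Proof.
move=> nb; have [Uy|nUy] := pselect ((U°) (act g y)).
  have : nbhs y (act g @^-1` U°).
    by apply: open_nbhs_nbhs; split=> //; apply: open_act_preimage => //;
      exact: open_interior.
  apply: filterS => y' /= /interior_subset Uy'; split=> // _.
  exact: interior_subset.
have ncl : ~ closure U (act g y) by move=> cl; apply: nb.
have : nbhs y (act g @^-1` (~` closure U)).
  apply: open_nbhs_nbhs; split=> //; apply: open_act_preimage => //.
  by apply: closed_openC; exact: closed_closure.
apply: filterS => y' /= ny'; split=> H; exfalso.
  by apply: ny'; exact: subset_closure.
by apply: ncl; exact: subset_closure.
Qed.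

End actions.

(** * Borel measures from finitely additive ones *)

Section regularisation.
Variables (R : realType) (X : ptopologicalType).
Hypotheses (X_compact : compact [set: X]) (X_hausdorff : hausdorff_space X).
Variable m : set X -> R.
Hypotheses (m_ge0 : forall A, 0 <= m A) (mT : m setT = 1).
Hypothesis mU : forall A B, A `&` B = set0 -> m (A `|` B) = m A + m B.

Lemma content_mono A B : A `<=` B -> m A <= m B.
Proof.
by move=> AB; rewrite -(setDUK AB) mU ?lerDl // setDIK.
Qed.

Lemma content0 : m set0 = 0.
Proof.
have := mU (set0I set0); rewrite setU0 => /eqP.
by rewrite -[X in X == _]addr0 (inj_eq (addrI _)) eq_sym => /eqP.
Qed.

Lemma contentU_le A B : m (A `|` B) <= m A + m B.
Proof.
have -> : A `|` B = A `|` (B `\` A).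
  apply/seteqP; split=> x; last by move=> [?|[? _]]; [left|right].
  by have [?|?] := pselect (A x); [left|move=> [|?]; [left|right]].
by rewrite mU ?lerD2l ?content_mono ?setDIK // => x [].
Qed.

(** A finitely additive probability is turned into a Borel measure in two
    steps: open sets are measured from inside by closed sets, and then
    arbitrary sets from outside by open sets. Compactness makes the first
    step countably subadditive. *)
Definition inner (U : set X) : R :=
  sup [set m K | K in [set K | closed K /\ K `<=` U]].

Lemma inner_has_sup U :
  has_sup [set m K | K in [set K | closed K /\ K `<=` U]].
Proof.
split; first by exists (m set0), set0 => //; split=> //; exact: closed0.
by exists 1 => _ [K _ <-]; rewrite -mT; exact: content_mono.
Qed.

Lemma le_inner K U : closed K -> K `<=` U -> m K <= inner U.
Proof. by move=> cK KU; apply: (ub_le_sup (inner_has_sup U).2); exists K. Qed.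

Lemma inner_leP U b :
  (forall K, closed K -> K `<=` U -> m K <= b) -> inner U <= b.
Proof.
move=> H; apply: (ge_sup (inner_has_sup U).1) => _ [K [cK KU] <-]; exact: H.
Qed.

Lemma inner_ge0 U : 0 <= inner U.
Proof. by rewrite -content0; apply: le_inner => //; exact: closed0. Qed.

Lemma closed_split (K U V : set X) :
  closed K -> open U -> open V -> K `<=` U `|` V ->
  exists K1 K2, [/\ closed K1, closed K2, K1 `<=` U, K2 `<=` V & K = K1 `|` K2].
Proof.
move=> cK oU oV KUV.
have /(@normal_openP R) nX := compact_normal X_hausdorff X_compact.
have [|||P [Q [oP oQ KP KQ PQ]]] := nX (K `\` U) (K `\` V).
- exact: closed_setD.
- exact: closed_setD.
- by apply/seteqP; split=> x //= [[Kx nU] [_ nV]]; case: (KUV x Kx).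
exists (K `\` P), (K `\` Q); split;
  [exact: closed_setD|exact: closed_setD| | |].
- by move=> x [Kx nP]; apply: contrapT => nU; apply: nP; apply: KP.
- by move=> x [Kx nP]; apply: contrapT => nU; apply: nP; apply: KQ.
- apply/seteqP; split=> x; last by case=> -[].
  move=> Kx; have [Px|nPx] := pselect (P x); last by left.
  by right; split=> // Qx; have : (P `&` Q) x by []; rewrite PQ.
Qed.

Lemma content_le_sum (K : set X) (U : nat -> set X) (s : seq nat) : closed K ->
  (forall i, open (U i)) -> K `<=` \bigcup_(i in [set` s]) U i ->
  m K <= \sum_(i <- s) inner (U i).
Proof.
move=> cK oU; elim: s K cK => [|a s IH] K cK KU.
  by rewrite big_nil (_ : K = set0) ?content0 // -subset0 => x /KU[].
have [||K1 [K2 [c1 c2 K1U K2U ->]]] :=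
  @closed_split K (U a) (\bigcup_(i in [set` s]) U i) cK (oU a).
- exact: bigcup_open.
- move=> x /KU[i]; rewrite /= inE => /predU1P[->|is_ Ux]; first by left.
  by right; exists i.
rewrite big_cons; apply: le_trans (contentU_le _ _) _.
by rewrite lerD ?IH // le_inner.
Qed.

Lemma inner_le_series (U : nat -> set X) : (forall i, open (U i)) ->
  ((inner (\bigcup_i U i))%:E <= \sum_(i <oo) (inner (U i))%:E)%E.
Proof.
move=> oU.
have sum_ge N : (\sum_(0 <= i < N) (inner (U i))%:E <= \sum_(i <oo) (inner (U
  i))%:E)%E.
  by apply: nneseries_lim_ge => n _ _; rewrite lee_fin inner_ge0.
case E : (\sum_(i <oo) (inner (U i))%:E)%E => [r| |]; last 2 first.
- by rewrite leey.
- by have := sum_ge 0%N; rewrite E big_geq.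
rewrite lee_fin; apply: inner_leP => K cK KU.
have [D _ KD] : finite_subset_cover [set: nat] U K.
  have : cover_compact K.
    rewrite -compact_cover; apply: (subclosed_compact cK X_compact) => //.
  by apply.
pose N := (\max_(i <- D) i).+1.
have := @content_le_sum K U (iota 0 N) cK oU.
rewrite -lee_fin => H; rewrite -lee_fin -E; apply: le_trans (sum_ge N).
rewrite -sumEFin in H; rewrite /index_iota subn0; apply: H.
move=> x /KD[i /= iD Ux]; exists i => //=.
suff : i \in iota 0 N by []; rewrite mem_iota /= add0n ltnS;
  exact: leq_bigmax_seq.
Qed.

Definition outer (A : set X) : R :=
  inf [set inner U | U in [set U | open U /\ A `<=` U]].

Lemma outer_has_inf A :
  has_inf [set inner U | U in [set U | open U /\ A `<=` U]].
Proof.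
split; first by exists (inner setT), setT => //; split=> //; exact: openT.
by exists 0 => _ [U _ <-]; exact: inner_ge0.
Qed.

Lemma outer_le A U : open U -> A `<=` U -> outer A <= inner U.
Proof. by move=> oU AU; apply: (ge_inf (outer_has_inf A).2); exists U. Qed.

Lemma le_outerP A b :
  (forall U, open U -> A `<=` U -> b <= inner U) -> b <= outer A.
Proof.
move=> H; apply: (lb_le_inf (outer_has_inf A).1) => _ [U [oU AU] <-].
exact: H.
Qed.

Lemma outer_ge0 A : 0 <= outer A.
Proof. by apply: le_outerP => U _ _; exact: inner_ge0. Qed.

Lemma outer_mono A B : A `<=` B -> outer A <= outer B.
Proof.
move=> AB; apply: le_outerP => U oU BU; apply: outer_le => //.
exact: subset_trans BU.
Qed.

Lemma outer0 : outer set0 = 0.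
Proof.
apply/eqP; rewrite eq_le outer_ge0 andbT.
apply: (le_trans (outer_le open0 (@subset_refl _ _))).
by apply: inner_leP => K _; rewrite subset0 => ->; rewrite content0.
Qed.

Lemma outerT : outer setT = 1.
Proof.
apply/eqP; rewrite eq_le; apply/andP; split.
  apply: (le_trans (outer_le openT (@subset_refl _ _))).
  by apply: inner_leP => K _ _; rewrite -mT; exact: content_mono.
apply: le_outerP => U _ TU; rewrite -mT; apply: le_inner => //.
Qed.

Lemma outer_sigma_subadditive :
  sigma_subadditive (fun A => (outer A)%:E : \bar R).
Proof.
move=> F; apply/lee_addgt0Pr => e e0.
apply: le_trans (epsilon_trick _ _ (ltW e0)); last first.
  by move=> n; rewrite lee_fin outer_ge0.
have /choice[U UP] n : exists U, [/\ open U, F n `<=` U &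
    inner U <= outer (F n) + e / (2 ^ n.+1)%:R].
  have en : 0 < e / (2 ^ n.+1)%:R by rewrite divr_gt0 // ltr0n expn_gt0.
  have [_ [U [oU FU] <-] lt] := inf_adherent en (outer_has_inf (F n)).
  by exists U; split=> //; exact: ltW.
have FU : \bigcup_n F n `<=` \bigcup_n U n.
  by move=> x [n _ Fx]; exists n => //; case: (UP n) => _ + _; exact.
have oU i : open (U i) by case: (UP i).
apply: (@le_trans _ _ (inner (\bigcup_n U n))%:E).
  by rewrite lee_fin; apply: outer_le => //; exact: bigcup_open.
apply: le_trans (inner_le_series oU) _.
apply: lee_nneseries => [i _|i _]; first by rewrite lee_fin inner_ge0.
by rewrite -EFinD lee_fin; case: (UP i).
Qed.

(** Carathéodory's criterion: a closed [K] almost filling [O `&` U] and then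
    a closed [L] almost filling [O `\` K] are disjoint subsets of [O]. *)
Lemma outer_caratheodory_open U A : open U ->
  outer (A `&` U) + outer (A `&` ~` U) <= outer A.
Proof.
move=> oU; apply: le_outerP => O oO AO.
rewrite -lerBrDr; apply: (@le_trans _ _ (inner (O `&` U))).
  by apply: outer_le; [exact: openI|exact: setSI].
apply: inner_leP => K cK KOU; rewrite lerBrDr addrC -lerBrDr.
apply: (@le_trans _ _ (inner (O `\` K))).
  apply: outer_le; first exact: open_setD.
  by move=> x [Ax nUx]; split; [exact: AO|move=> /KOU[]].
apply: inner_leP => L cL LOK; rewrite lerBrDr addrC -mU.
  apply: le_inner; first exact: closedU.
  by move=> x [/KOU[]|/LOK[]].
by apply/seteqP; split=> x // [Kx /LOK[]].
Qed.

Theorem content_regularisation : exists mu : probability (borel X) R,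
  forall A, measurable A -> mu A = (outer A)%:E.
Proof.
pose om (A : set X) : \bar R := (outer A)%:E.
have om0 : om set0 = 0%E by rewrite /om outer0.
have om_ge0 A : (0 <= om A)%E by rewrite lee_fin outer_ge0.
have om_mono : {homo om : A B / A `<=` B >-> (A <= B)%E}.
  by move=> A B AB; rewrite lee_fin outer_mono.
pose OM : {outer_measure set X -> \bar R} := HB.pack om
  (isOuterMeasure.Build R X om om0 om_ge0 om_mono outer_sigma_subadditive).
have cara A : measurable (A : set (borel X)) -> caratheodory_measurable OM A.
  move=> mA; pose car := @measurable _ (caratheodory_type OM).
  suff : car A by [].
  apply: mA; split; last first.
    move=> U oU; apply: le_caratheodory_measurable => Y.
    by rewrite /= /om -EFinD lee_fin outer_caratheodory_open.
  exact: sigma_algebra_measurable.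
have sadd : semi_sigma_additive (om : set (borel X) -> \bar R).
  move=> F mF tF mUF.
  apply: (@caratheodory_measure_sigma_additive R X OM) => //.
  - by move=> i; exact: cara.
  - exact: cara.
have [mu0 mu0E] : exists mu0 : {measure set (borel X) -> \bar R},
    forall A, mu0 A = om A.
  pose mu1 : {measure set (borel X) -> \bar R} :=
    HB.pack (om : set (borel X) -> \bar R)
      (isMeasure.Build _ (borel X) R om om0 om_ge0 sadd).
  by exists mu1.
(* normalising a measure of mass one packages it as a probability *)
have muT : mu0 setT = 1%E by rewrite mu0E /om outerT.
exists (mnormalize mu0 (dirac (point : borel X))) => A _.
by rewrite /= /mnormalize muT orbF onee_eq0 /= invr1 mule1 mu0E.
Qed.

Lemma outer_preimage_le (f g : X -> X) A : continuous f -> continuous g ->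
  cancel f g -> cancel g f -> (forall B, m (f @^-1` B) = m B) ->
  outer (f @^-1` A) <= outer A.
Proof.
move=> cf cg fg gf mf; apply: le_outerP => U oU AU.
apply: (@le_trans _ _ (inner (f @^-1` U))).
  apply: outer_le => //; first by apply: open_comp => // x _; exact: cf.
  by move=> x /AU.
apply: inner_leP => K cK KU.
have -> : K = f @^-1` (g @^-1` K).
  by apply/seteqP; split=> x /=; rewrite fg.
rewrite mf; apply: le_inner => //.
  by apply: closed_comp => // x _; exact: cg.
by move=> x /= /KU; rewrite /= gf.
Qed.

Lemma outer_preimage (f g : X -> X) A : continuous f -> continuous g ->
  cancel f g -> cancel g f -> (forall B, m (f @^-1` B) = m B) ->
  outer (f @^-1` A) = outer A.
Proof.
move=> cf cg fg gf mf; apply/eqP.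
rewrite eq_le (outer_preimage_le (g := g)) //=.
have {1}-> : A = g @^-1` (f @^-1` A).
  by apply/seteqP; split=> x /=; rewrite gf.
apply: (outer_preimage_le (g := f)) => // B.
by rewrite -mf; congr m; apply/seteqP; split=> x /=; rewrite fg.
Qed.

(** By normality a closed set has a closed neighbourhood inside each of its
    open neighbourhoods, so it loses no mass in the regularisation. *)
Lemma outer_closed_ge (C : set X) d : closed C ->
  (forall U, open U -> C `<=` U -> d <= m U) -> d <= outer C.
Proof.
move=> cC H; apply: le_outerP => U oU CU.
have /(@normal_openP R) nX := compact_normal X_hausdorff X_compact.
have [||P [Q [oP oQ CP UQ PQ]]] := nX C (~` U) cC.
- exact: open_closedC.
- by apply/seteqP; split=> x // [/CU].
apply: le_trans (H P oP CP) _; apply: (@le_trans _ _ (m (~` Q))).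
  apply: content_mono => // x Px Qx.
  by have : (P `&` Q) x by []; rewrite PQ.
apply: le_inner => //; first exact: open_closedC.
by move=> x nQ; apply: contrapT => nU; apply: nQ; apply: UQ.
Qed.

End regularisation.

(** * Matching by a queue *)

Section queue.
Variables (R : realType) (X : topologicalType).
Implicit Types (f w v : X -> R) (S T : X -> X).

Definition birkhoff T f n x : R := \sum_(j < n) f (iter j T x).

Lemma birkhoffS T f n x : birkhoff T f n.+1 x = f x + birkhoff T f n (T x).
Proof.
rewrite /birkhoff big_ord_recl /=; congr (_ + _).
by apply: eq_bigr => j _; rewrite -iterS iterSr.
Qed.

Lemma birkhoffD T f m n x :
  birkhoff T f (m + n) x = birkhoff T f m x + birkhoff T f n (iter m T x).
Proof.
elim: m x => [|m IH] x; first by rewrite add0n /birkhoff big_ord0 add0r.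
by rewrite addSn !birkhoffS IH addrA iterSr.
Qed.

Lemma birkhoffSr T f n x :
  birkhoff T f n.+1 x = birkhoff T f n x + f (iter n T x).
Proof. by rewrite /birkhoff big_ord_recr. Qed.

Lemma birkhoffB T f g n x :
  birkhoff T (fun y => f y - g y) n x = birkhoff T f n x - birkhoff T g n x.
Proof. by rewrite /birkhoff sumrB. Qed.

Lemma iter_inj S T k : cancel T S -> injective (iter k T).
Proof.
by move=> TS; elim: k => //= k IH x y /(can_inj TS)/IH.
Qed.

Lemma continuous_iter T j : continuous T -> continuous (iter j T).
Proof.
move=> cT; elim: j => [|j IH] x; first exact: cvg_id.
by apply: continuous_comp; [exact: IH|exact: cT].
Qed.

Lemma continuous_birkhoff T f n :
  continuous T -> continuous f -> continuous (birkhoff T f n).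
Proof.
move=> cT cf; elim: n => [|n IH] x.
  rewrite (_ : birkhoff T f 0 = cst 0); first exact: cvg_cst.
  by apply/funext => y; rewrite /birkhoff big_ord0.
rewrite (_ : birkhoff T f n.+1 = birkhoff T f n \+ (f \o iter n T)).
  apply: cvgD; first exact: IH.
  by apply: continuous_comp; [exact: continuous_iter|exact: cf].
by apply/funext => y; rewrite birkhoffSr.
Qed.

(** Lindley's formula: with net inflow [f], the backlog found on arrival at
    [x] is the largest net inflow over a past segment, here of length less
    than [n]. *)
Fixpoint queue S f n x : R :=
  if n is m.+1 then Num.max (queue S f m x) (birkhoff S f m (S x)) else 0.

Lemma queue_ge0 S f n x : 0 <= queue S f n x.
Proof. by elim: n => //= n IH; rewrite le_max IH. Qed.

Lemma queueP S f n x b : 0 <= b ->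
  (forall i, (i < n)%N -> birkhoff S f i (S x) <= b) -> queue S f n x <= b.
Proof.
move=> b0; elim: n => //= n IH H; rewrite ge_max H // IH // => i /ltnW.
exact: H.
Qed.

Lemma continuous_queue S f n :
  continuous S -> continuous f -> continuous (queue S f n).
Proof.
move=> cS cf; elim: n => [|n IH] x.
  exact: cvg_cst.
rewrite (_ : queue S f n.+1 = queue S f n \max (birkhoff S f n \o S)).
  apply: continuous_max; first exact: IH.
  by apply: continuous_comp; [exact: cS|exact: continuous_birkhoff].
by [].
Qed.

Lemma queue_le_birkhoff S f n i x : (i < n)%N ->
  birkhoff S f i (S x) <= queue S f n x.
Proof.
elim: n => //= n IH; rewrite ltnS leq_eqVlt le_max => /predU1P[->|/IH->//].
by rewrite lexx orbT.
Qed.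

Lemma birkhoff_inv S T f n x : cancel T S -> cancel S T ->
  birkhoff S f n (iter n T x) = birkhoff T f n (T x).
Proof.
move=> TS ST; elim: n x => [|n IH] x; first by rewrite /birkhoff !big_ord0.
by rewrite birkhoffS birkhoffSr iterS TS IH addrC -iterSr iterS.
Qed.

Variables (S T : X -> X) (w v : X -> R) (n N : nat).
Hypotheses (cT : continuous T) (cS : continuous S).
Hypotheses (TS : cancel T S) (ST : cancel S T).
Hypotheses (cw : continuous w) (cv : continuous v).
Hypothesis w03 : forall x, 0 <= w x <= 3.
Hypothesis v01 : forall x, 0 <= v x <= 1.
Hypothesis n_gt0 : (0 < n)%N.
Hypothesis wv : forall x, birkhoff T w n x <= birkhoff T v n x.
Hypothesis vN : forall x, 3 * n%:R + 1 < birkhoff T v N x.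

(* Q is the backlog found by the work arriving at x, and A s the capacity
   offered by the first s steps from x on *)
Let Q := queue S (fun y => w y - v y) n.
Let A s x := birkhoff T v s x.

Let Q_le x : Q x <= 3 * n%:R.
Proof.
apply: queueP => [|i lin]; first by rewrite mulr_ge0.
apply: (@le_trans _ _ (\sum_(j < i) (3 : R))).
  apply: ler_sum => j _; have := w03 (iter j S (S x)).
  have := v01 (iter j S (S x)); lra.
by rewrite sumr_const card_ord -[3 *+ i]mulr_natr ler_pM2l // ler_nat ltnW.
Qed.

(* Over a past of length n the net inflow is nonpositive, so truncating the
   look-back at n loses nothing. *)
Let Q_step x : Q x + (w x - v x) <= Q (T x).
Proof.
rewrite -lerBrDr.
suff H i : (i < n)%N -> birkhoff S (fun y => w y - v y) i (S x) <=
    Q (T x) - (w x - v x).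
  apply: (queueP _ H).
  by apply: le_trans (H 0%N n_gt0); rewrite /birkhoff big_ord0.
move=> ltin.
rewrite lerBrDr addrC.
have E : birkhoff S (fun y => w y - v y) i.+1 (S (T x)) =
    w x - v x + birkhoff S (fun y => w y - v y) i (S x).
  by rewrite birkhoffS TS.
rewrite -E; have [lin|] := ltnP i.+1 n; first exact: queue_le_birkhoff.
move=> nle; have -> : i.+1 = n by apply/eqP; rewrite eqn_leq nle andbT.
apply: le_trans (queue_ge0 _ _ _ _); rewrite TS.
have xE : x = iter n T (iter n S x).
  by elim: (n) (x) => // m IH y; rewrite iterSr /= ST -IH.
have := wv (T (iter n S x)).
rewrite -subr_le0 -birkhoffB -(birkhoff_inv _ _ _ TS ST) -xE //.
Qed.

Let Q_steps x d : Q x + (birkhoff T w d x - A d x) <= Q (iter d T x).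
Proof.
elim: d => [|d IH]; first by rewrite /A /birkhoff !big_ord0 subrr addr0.
have := Q_step (iter d T x); rewrite iterS /A !birkhoffSr -/(A d x).
move: IH; lra.
Qed.

(* The work arriving at x is served while the offered capacity runs through
   the interval from Q x to Q x + w x; step s belongs to x when the capacity
   it offers lies strictly inside. A step of capacity zero is not a target. *)
Let U (s : 'I_N) :=
  [set x | Q x < A s x /\ A s.+1 x < Q x + w x /\ 0 < v (iter s T x)].

(* First in, first out: work arriving later is served later. *)
Let Ufifo s t x y : U s x -> U t y -> (t < s)%N ->
  iter s T x = iter t T y -> False.
Proof.
move=> [_ [Ux _]] [Uy _] ts e.
have sE : (s = (s - t) + t :> nat)%N by rewrite subnK // ltnW.
have yE : y = iter (s - t) T x.
  by move: e; rewrite {1}sE addnC iterD => /(iter_inj TS) <-.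
have d0 : (0 < s - t)%N by rewrite subn_gt0.
have := Q_steps x (s - t); rewrite -yE.
have lw : w x <= birkhoff T w (s - t) x.
  move: d0; case: (s - t)%N => // d _; rewrite birkhoffS lerDl.
  by apply: sumr_ge0 => j _; case/andP: (w03 (iter j T (T x))).
move: Ux; rewrite /A birkhoffSr {1}sE birkhoffD -yE.
move: Uy; rewrite /A; move: (v01 (iter s T x)); lra.
Qed.

(** The value 3 leaves room for one complete step of capacity at most 1
    strictly inside an interval of length [w], wherever the interval starts.
    The sets [V s] may overlap: a point lying in several of them owns
    several targets, and no target has two owners. *)
Theorem fifo_matching : exists V : 'I_N -> set X,
  [/\ forall s, open (V s),
      [set x | w x = 3] `<=` \bigcup_(s in setT) V s,
      forall s x, V s x -> 0 < v (iter s T x)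
    & forall s t x y, V s x -> V t y -> iter s T x = iter t T y ->
        s = t /\ x = y].
Proof.
exists U; split.
- move=> s.
  have cQ : continuous Q.
    by apply: continuous_queue => // x; apply: cvgB; [exact: cw|exact: cv].
  have cA k : continuous (A k) by exact: continuous_birkhoff.
  rewrite (_ : U s = (fun x => A s x - Q x) @^-1` [set r | 0 < r] `&`
     ((fun x => Q x + w x - A s.+1 x) @^-1` [set r | 0 < r] `&`
     (fun x => v (iter s T x)) @^-1` [set r | 0 < r])).
    apply: openI; last apply: openI; apply: open_comp (@open_gt _ 0) => x _.
    + by apply: cvgB; [exact: cA|exact: cQ].
    + by apply: cvgB; [apply: cvgD; [exact: cQ|exact: cw]|exact: cA].
    + apply: (@continuous_comp _ _ _ (iter s T) v); last exact: cv.
      exact: continuous_iter.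
  by apply/seteqP; split=> x; rewrite /U /= !subr_gt0.
- move=> x /= w3.
  (* the first step ending beyond Q x + 1 starts beyond Q x and ends before
     Q x + 3 *)
  have ex : exists s, Q x + 1 < A s.+1 x.
    have := vN x; have := Q_le x; case: (N) => [|k] q; last first.
      by move=> h; exists k; rewrite /A; lra.
    by rewrite /birkhoff big_ord0; have := queue_ge0 S (fun y => w y - v y) n x;
       rewrite -/(Q x); lra.
  case: (ex_minnP ex) => s ls mins.
  have As : A s x <= Q x + 1.
    rewrite leNgt; apply/negP; case: s ls mins => [|s] ls mins.
      rewrite /A /birkhoff big_ord0.
      by have := queue_ge0 S (fun y => w y - v y) n x; rewrite -/(Q x); lra.
    by move=> /mins; rewrite ltnn.
  have sN : (s < N)%N.
    have [k NE] : exists k, N = k.+1.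
      case: N vN => [|k] vN0; last by exists k.
      by have := vN0 x; rewrite /birkhoff big_ord0; have : 0 <= n%:R :> R by [];
        lra.
    by rewrite NE ltnS mins // /A -NE; have := vN x; have := Q_le x; lra.
  exists (Ordinal sN) => //; rewrite /U /=.
  by move: ls; rewrite w3 /A birkhoffSr -/(A s x); have := v01 (iter s T x);
    lra.
- by move=> s x [_ [_]].
- move=> s t x y Usx Uty e; have [ts|st|/val_inj st] := ltngtP t s.
  + by case: (Ufifo Usx Uty ts e).
  + by case: (Ufifo Uty Usx st (esym e)).
  + by subst t; split=> //; exact: (iter_inj TS e).
Qed.

End queue.

(** * Orbit averages near a null set *)

Lemma ultra_limit (R : realType) (T : Type) (F : set_system T) (u : T -> R) :
  UltraFilter F -> (forall t, 0 <= u t <= 1) ->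
  exists2 l : R, 0 <= l <= 1 & u @ F --> l.
Proof.
move=> FU u01; have FF := @ultra_proper _ _ FU.
have [|l [l01 cl]] := @segment_compact R 0 1 (u @ F) _.
  by apply: (@filterE _ F) => t; rewrite /= in_itv /= u01.
exists l; first by move: l01; rewrite /= in_itv.
move=> B /= nB; have [//|FC] := in_ultra_setVsetC (u @^-1` B) FU.
by have [r []] := cl (~` B) B FC nB.
Qed.

Section shift.
Variables (R : realType) (phi : int -> R).
Hypothesis phi01 : forall k, 0 <= phi k <= 1.

Lemma shift_sum_nat (n h : nat) (a : int) :
  `|\sum_(j < n) phi (a + h%:Z + j%:Z) - \sum_(j < n) phi (a + j%:Z)| <= h%:R.
Proof.
elim: h a => [|h IH] a.
  by under eq_bigr do rewrite addr0; rewrite subrr normr0.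
have E : (\sum_(j < n) phi (a + 1 + j%:Z)) - \sum_(j < n) phi (a + j%:Z) =
   phi (a + n%:Z) - phi a.
  elim: (n) => [|p IHp]; first by rewrite !big_ord0 addr0 !subrr.
  have -> : a + p.+1%:Z = a + 1 + p%:Z by rewrite intS addrA.
  rewrite !big_ord_recr /= opprD addrACA IHp; ring.
have := IH (a + 1); under eq_bigr do rewrite -[a + 1 + h%:Z]addrA -intS.
have := phi01 (a + n%:Z); have := phi01 a.
move: E; set s1 := \sum_(j < n) _; set s2 := \sum_(j < n) _; set s3 :=
  \sum_(j < n) _.
rewrite !ler_norml [in h.+1%:R]mulrS; lra.
Qed.

Lemma shift_sum (n : nat) (h : int) :
  `|\sum_(j < n) phi (h + j%:Z) - \sum_(j < n) phi j%:Z| <= `|h|%:~R.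
Proof.
case: h => h.
  have := shift_sum_nat n h 0; under eq_bigr do rewrite add0r.
  by under [X in _ - X]eq_bigr do rewrite add0r.
have := shift_sum_nat n h.+1 (Negz h).
have -> : Negz h + h.+1%:Z = 0 by rewrite NegzE addNr.
by rewrite distrC; under [X in _ - X]eq_bigr do rewrite add0r.
Qed.

End shift.

Section small_average.
Variables (R : realType) (G : groupType) (X : pmetricType R).
Variables (act : G -> X -> X) (sd : strands G).
Hypotheses (X_compact : compact [set: X]) (act_homeo : action_by_homeo act).
Let z := zpow sd.
Let rs := reps sd.

Lemma rep_mulg_inj g : {in rs &, injective (fun r => rep sd (g * r)%g)}.
Proof.
move=> r r' rin r'in /= e.
have E := rep_height sd (g * r)%g; have E' := rep_height sd (g * r')%g.
rewrite -(rep_id rin) -(rep_id r'in).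
move: (height sd (g * r)%g) (height sd (g * r')%g) E E' => a b E E'.
suff -> : r' = (r * z (b - a)%R)%g.
  by rewrite rep_zpow.
apply: (@mulgI _ g); rewrite mulgA E E' -e -mulgA -(zpowD sd).
by rewrite addrCA subrr addr0.
Qed.

Lemma perm_rep_mulg g : perm_eq [seq rep sd (g * r)%g | r <- rs] rs.
Proof.
have u : uniq [seq rep sd (g * r)%g | r <- rs].
  by rewrite map_inj_in_uniq ?reps_uniq //; exact: rep_mulg_inj.
apply: uniq_perm => //; first exact: reps_uniq.
have [] // := @uniq_min_size _ _ rs u; last by rewrite size_map.
by move=> _ /mapP[r _ ->]; exact: rep_mem.
Qed.

Lemma reps_gt0 : (0 < size rs)%N.
Proof. by have := rep_mem sd 1%g; rewrite -/rs; case: (rs). Qed.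

Lemma indic01 (A : set X) y : 0 <= (\1_A y : R) <= 1.
Proof. by rewrite indicE; case: (_ \in _); rewrite ?lexx ?ler01. Qed.

Definition visits (A : set X) n x : R :=
  \sum_(r <- rs) \sum_(j < n) \1_A (act (r * z j%:Z)%g x).

(** Left multiplication by [g] permutes the strands and moves each of them
    by a bounded amount, so the sets of all [r b^j] with [j < n] are
    asymptotically invariant. *)
Lemma visits_shift A g n x :
  `|visits (act g @^-1` A) n x - visits A n x| <=
  \sum_(r <- rs) `|height sd (g * r)%g|%:~R.
Proof.
pose phi r k : R := \1_A (act (r * z k)%g x).
have -> : visits A n x =
    \sum_(r <- rs) \sum_(j < n) phi (rep sd (g * r)%g) j%:Z.
  by rewrite /visits -(perm_big _ (perm_rep_mulg g)) big_map.
rewrite -sumrB; apply: le_trans (ler_norm_sum _ _ _) _.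
apply: ler_sum => r _.
have -> : \sum_(j < n) \1_(act g @^-1` A) (act (r * z j)%g x) =
    \sum_(j < n) phi (rep sd (g * r)%g) (height sd (g * r)%g + j%:Z).
  apply: eq_bigr => j _; rewrite /phi /z zpowD mulgA -rep_height -mulgA.
  by rewrite (actM act_homeo g) !indicE.
by apply: shift_sum => k; exact: indic01.
Qed.

Definition invariant_null (A : set X) :=
  forall mu : probability (borel X) R, invariant_probability act mu ->
    mu A = 0%E.

(** Otherwise there are longer and longer orbit segments that spend a fixed
    proportion of their time in smaller and smaller neighbourhoods of [C].
    An ultralimit of the corresponding empirical averages is invariant and
    gives every neighbourhood of [C] a fixed mass, and so does its Borel
    regularisation. The length is asked to be a multiple of [M] so that it
    can be matched with a lower bound known on segments of length [M]. *)
Lemma invariant_null_average (C : set X) (delta : R) (M : nat) :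
  closed C -> invariant_null C -> 0 < delta -> (0 < M)%N ->
  exists (n : nat) (w : X -> R), [/\ (0 < n)%N, (M %| n)%N, continuous w,
    forall x, 0 <= w x <= 1 &
    (forall x, C x -> w x = 1) /\
    forall x, birkhoff (act (z 1)) w n x <= delta * n%:R].
Proof.
move=> cC nullC d0 M0; apply: contrapT => none.
have X_haus : hausdorff_space X by exact: metric_hausdorff.
have C_compact : compact C by apply: (subclosed_compact cC X_compact).
pose N k := (k.+1 * M)%N.
have N0 k : (0 < N k)%N by rewrite muln_gt0.
pose W k := \bigcup_(c in C) ball c (k.+1%:R^-1 : R).
have CW k : C `<=` (W k)°.
  move=> c Cc; have k0 : 0 < k.+1%:R^-1 :> R by rewrite invr_gt0.
  apply: filterS (nbhsx_ballx c _ k0) => y cy; by exists c.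
have /choice[x xP] k : exists x, delta * (N k)%:R <=
    \sum_(j < N k) \1_(W k) (act (z j%:Z) x).
  apply: contrapT => nox; apply: none.
  have sep : uniform_separator (~` (W k)°) C.
    apply: normal_uniform_separator => //.
    - exact: compact_normal.
    - by apply: open_closedC; exact: open_interior.
    - by apply/seteqP; split=> y // [ny /CW /ny].
  have [w [cw w01 w0 w1]] := (@uniform_separatorP _ R _ _).1 sep.
  have w01' y : 0 <= w y <= 1 by have := w01 (w y); rewrite /= in_itv /=; apply;
    exists y.
  exists (N k), w; split=> //; first exact: dvdn_mull.
  split=> [y Cy|y]; first by apply: w1; exists y.
  rewrite leNgt; apply/negP => lt; apply: nox; exists y.
  apply: le_trans (ltW lt) _; apply: ler_sum => j _.
  rewrite (iter_zpow act_homeo) indicE; set y' := act _ y.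
  case: (boolP (y' \in _)) => [_|/negP nW]; first by case/andP: (w01' y').
  rewrite (w0 (w y')) //; exists y' => // /interior_subset Wy'.
  by apply: nW; exact: mem_set.
pose e k A := visits A (N k) (x k) / ((size rs)%:R * (N k)%:R).
have den0 k : 0 < (size rs)%:R * (N k)%:R :> R.
  by rewrite mulr_gt0 ?ltr0n // reps_gt0.
have e01 A k : 0 <= e k A <= 1.
  rewrite /e divr_ge0 ?(ltW (den0 k)) //=; last first.
    by apply: sumr_ge0 => r _; apply: sumr_ge0 => j _;
       case/andP: (indic01 A (act (r * z j%:Z)%g (x k))).
  rewrite ler_pdivrMr // mul1r.
  apply: (@le_trans _ _ (\sum_(r <- rs) \sum_(j < N k) 1)).
    apply: ler_sum => r _; apply: ler_sum => j _.
    by case/andP: (indic01 A (act (r * z j%:Z)%g (x k))).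
  by rewrite big_const_seq count_predT iter_addr addr0 sumr_const card_ord
    mulr_natl.
have [F [FU ooF]] := ultraFilterLemma (eventually_filter : ProperFilter \oo).
have FF := @ultra_proper _ _ FU.
have /choice[m mP] A : exists l : R, 0 <= l <= 1 /\ e k A @[k --> F] --> l.
  by have [l l01 cl] := ultra_limit FU (e01 A); exists l.
have m01 A : 0 <= m A <= 1 by case: (mP A).
have m_cvg A : e k A @[k --> F] --> m A by case: (mP A).
have m_ge0 A : 0 <= m A by case/andP: (m01 A).
have mT : m setT = 1.
  apply: (cvg_unique _ (m_cvg setT)) => //.
  have -> : e ^~ setT = cst 1.
    apply/funext => k; rewrite /e /visits.
    have -> : \sum_(r <- rs) \sum_(j < N k) \1_setT (act (r * z j%:Z)%g (x k)) =
        (size rs)%:R * (N k)%:R :> R.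
      transitivity (\sum_(r <- rs) \sum_(j < N k) (1 : R)).
        by apply: eq_bigr => r _; apply: eq_bigr => j _; rewrite indicE in_setT.
      by rewrite big_const_seq count_predT iter_addr addr0 sumr_const card_ord
        mulr_natl.
    by rewrite divff // gt_eqF.
  exact: cvg_cst.
have mU A B : A `&` B = set0 -> m (A `|` B) = m A + m B.
  move=> AB0; apply: (cvg_unique _ (m_cvg (A `|` B))) => //.
  have -> : e ^~ (A `|` B) = e ^~ A \+ e ^~ B.
    apply/funext => k; rewrite /e /= -mulrDl /visits -big_split /=;
      congr (_ / _).
    apply: eq_bigr => r _; rewrite -big_split /=; apply: eq_bigr => j _.
    rewrite !indicE in_setU; set y := act _ _.
    case: (boolP (y \in A)) => [/set_mem Ay|_]; last by rewrite add0r.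
    case: (boolP (y \in B)) => [/set_mem By|_]; last by rewrite addr0.
    by have : (A `&` B) y by []; rewrite AB0.
  by apply: cvgD.
have N_ge k : k.+1%:R <= (N k)%:R :> R by rewrite ler_nat leq_pmulr.
have invN c : c / (N k)%:R @[k --> F] --> (0 : R).
  suff H : c / (N k)%:R @[k --> \oo] --> (0 : R) by move=> B nB;
    exact: ooF (H B nB).
  rewrite -(mulr0 c); apply: cvgMr.
  apply: (@squeeze_cvgr _ _ _ _ (cst 0) (fun k => k.+1%:R^-1)).
  - apply: nearW => k; rewrite /= invr_ge0 ler0n /=.
    by rewrite lef_pV2 ?posrE ?ltr0n.
  - exact: cvg_cst.
  - exact: cvg_harmonic.
(* the error in visits_shift is bounded, while the segments grow *)
have m_inv g A : m (act g @^-1` A) = m A.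
  apply/eqP; rewrite -subr_eq0; apply/eqP.
  apply: (cvg_unique _ (cvgB (m_cvg (act g @^-1` A)) (m_cvg A))) => //.
  apply: norm_cvg0.
  pose c := \sum_(r <- rs) `|height sd (g * r)%g|%:~R : R.
  apply: (@squeeze_cvgr _ _ _ _ (cst 0) (fun k => c / (N k)%:R)) => //.
  - apply: nearW => k; rewrite /= normr_ge0 /= /e -mulrBl normrM.
    rewrite [X in _ * X]ger0_norm ?invr_ge0 ?(ltW (den0 k)) //.
    apply: (@le_trans _ _ (c / ((size rs)%:R * (N k)%:R))).
      by rewrite ler_wpM2r ?invr_ge0 ?(ltW (den0 k)) // visits_shift.
    rewrite ler_wpM2l //; first by apply: sumr_ge0 => r _; rewrite ler0z.
    rewrite lef_pV2 ?posrE ?den0 ?ltr0n //.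
    by rewrite -[leLHS]mul1r ler_wpM2r // ler1n reps_gt0.
  - exact: cvg_cst.
have [mu muE] := content_regularisation X_compact X_haus m_ge0 mT mU.
have mu_inv : invariant_probability act mu.
  move=> g A mA; rewrite !muE //; first last.
    by apply: preimage_borel mA; exact: (act_continuous act_homeo).
  congr (_%:E); apply: (outer_preimage m_ge0 mT mU (g := act g^-1%g)) => //.
  + exact: (act_continuous act_homeo).
  + exact: (act_continuous act_homeo).
  + exact: (actK act_homeo).
  + exact: (actKV act_homeo).
have mC : measurable (C : set (borel X)) by exact: closed_borel.
(* half of delta pays for the shift h0 below *)
have d_gt0 : 0 < delta / 2 / (size rs)%:R
  by rewrite !divr_gt0 // ltr0n reps_gt0.
have := nullC mu mu_inv; rewrite muE // => -[] /eqP; rewrite gt_eqF //.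
apply: lt_le_trans d_gt0 _.
apply: (outer_closed_ge X_compact X_haus m_ge0 mT mU) => // U oU CU.
apply: (closed_cvg (fun r : R =>
  delta / 2 / (size rs)%:R <= r) _ _ _ (m_cvg U)).
  exact: closed_ge.
(* the strand of the identity, up to the shift h0, is the segment itself *)
pose r0 := rep sd 1%g; pose h0 := height sd 1%g.
apply: ooF.
have H1 := compact_nbhd_ball C_compact oU CU.
have H2 : \forall k \near \oo, `|h0|%:~R / (delta / 2) <= k%:R
  by exact: nbhs_infty_ger.
apply: filterS2 H1 H2 => k WU kl.
rewrite /= /e ler_pdivlMr //.
have -> : delta / 2 / (size rs)%:R * ((size rs)%:R * (N k)%:R) =
    delta / 2 * (N k)%:R.
  by rewrite mulrA divfK // gt_eqF // ltr0n reps_gt0.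
pose phi i : R := \1_U (act (r0 * z i)%g (x k)).
have le1 : \sum_(j < N k) phi j%:Z <= visits U (N k) (x k).
  rewrite /visits (big_rem r0) /=; last exact: rep_mem.
  rewrite lerDl; apply: sumr_ge0 => r _; apply: sumr_ge0 => j _.
  by case/andP: (indic01 U (act (r * z j%:Z)%g (x k))).
have le2 : delta * (N k)%:R <= \sum_(j < N k) phi (h0 + j%:Z).
  apply: le_trans (xP k) _; apply: ler_sum => j _.
  rewrite /phi /z zpowD mulgA -rep_height mul1g !indicE.
  by case: (boolP (_ \in _)) => [/set_mem/WU Uy|_];
    [rewrite mem_set|rewrite ler0n].
have phi01 i : 0 <= phi i <= 1 by exact: indic01.
have := shift_sum phi01 (N k) h0; rewrite ler_norml => /andP[_ le3].
have le4 : `|h0|%:~R <= delta / 2 * (N k)%:R.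
  rewrite mulrC -ler_pdivrMr ?divr_gt0 //; apply: le_trans kl _.
  by apply: le_trans (N_ge k); rewrite ler_nat.
by move: le1 le2 le3 le4; lra.
Qed.

End small_average.

(** * Closed null sets are small *)

Section comparison.
Variables (R : realType) (G : groupType) (X : pmetricType R).
Variable act : G -> X -> X.
Hypotheses (X_compact : compact [set: X]) (act_homeo : action_by_homeo act).

Lemma dyn_subequiv_fin (I : finType) (V : I -> set X) (s : I -> G)
    (C O : set X) :
  (forall i, open (V i)) -> C `<=` \bigcup_(i in setT) V i ->
  (forall i j x y, V i x -> V j y -> act (s i) x = act (s j) y -> i = j) ->
  (forall i x, V i x -> O (act (s i) x)) -> dyn_subequiv act C O.
Proof.
move=> oV CV disj VO.
exists #|I|, (fun k => V (enum_val k)), (fun k => s (enum_val k)); split=> //.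
- move=> x /CV[i _ Vx]; exists (enum_rank i) => //.
  by rewrite enum_rankK.
- move=> k l _ _ [_ [[x Vx <-] [y Vy e]]]; apply: enum_val_inj.
  exact: (disj _ _ _ _ Vx Vy (esym e)).
- by move=> _ [k _ [x Vx <-]]; exact: VO.
Qed.

Hypotheses (X_inf : infinite_set [set: X]) (act_min : minimal_action act).

(** If an open set met an orbit in a finite set, it would by density be that
    finite set, and its finitely many translates covering the space would be
    finite too. *)
Lemma orbit_infinite (O : set X) x : open O -> O !=set0 ->
  infinite_set (O `&` range (act^~ x)).
Proof.
move=> oO O0 fin; apply: X_inf; set A := O `&` _ in fin.
have cA : closed A.
  apply: compact_closed; first exact: metric_hausdorff.
  exact: finite_compact.
have OA : O `<=` A.
  move=> y Oy; apply: contrapT => nAy.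
  have [g [Og nAg]] : exists g, (O `\` A) (act g x).
    by apply: orbit_meets => //; [exact: open_setD|exists y].
  by apply: nAg; split=> //; exists g.
have [D DX] : exists D : {fset G},
    forall y, exists2 g, g \in D & (act g @^-1` O) y.
  apply: finite_subcover => // [g|y]; first
    exact: (open_act_preimage act_homeo).
  exact: (orbit_meets y act_min oO O0).
apply: (@sub_finite_set _ _ (\bigcup_(g in [set` D]) (act g @^-1` A))).
  by move=> y _; have [g gD Oy] := DX y; exists g => //; exact: OA.
apply: bigcup_finite; first exact: finite_fset.
by move=> g _; apply: finite_preimage => // y y' _ _;
  exact: (act_inj act_homeo).
Qed.

Lemma disjoint_translates (O : set X) x n : open O -> O !=set0 ->
  exists (h : 'I_n -> G) (B : set X), [/\ open B, B x,
    forall i y, B y -> O (act (h i) y) &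
    forall i j y y', B y -> B y' -> act (h i) y = act (h j) y' -> i = j].
Proof.
move=> oO O0.
have [D DA szD] := infinite_set_fset n (orbit_infinite (x := x) oO O0).
have /choice[h hP] (i : 'I_n) : exists g, act g x = nth x D i.
  have : nth x D i \in D by apply: mem_nth; apply: leq_trans szD.
  by move=> /DA[_ [g _ <-]]; exists g.
have h_inj i j : act (h i) x = act (h j) x -> i = j.
  have lt k : (nat_of_ord (k : 'I_n) < size D)%N by exact: leq_trans szD.
  rewrite !hP => /eqP; rewrite nth_uniq ?fset_uniq // => /eqP; exact: val_inj.
have hO i : O (act (h i) x).
  rewrite hP; have : nth x D i \in D by apply: mem_nth; apply: leq_trans szD.
  by move=> /DA[].
have sep (p : 'I_n * 'I_n) : exists AB : set X * set X,
    p.1 != p.2 -> [/\ nbhs x (act (h p.1) @^-1` AB.1),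
      nbhs x (act (h p.2) @^-1` AB.2) & AB.1 `&` AB.2 = set0].
  case: p => i j /=.
  have [->|ij] := eqVneq i j; first by exists (set0, set0).
  have ne : act (h i) x != act (h j) x by apply: contra_neq ij; exact: h_inj.
  have := @metric_hausdorff _ X; rewrite open_hausdorff => /(_ _ _ ne).
  move=> [[A B] /= [Ai Bj] [oA oB /eqP AB0]]; exists (A, B) => _ /=; split=> //.
  - by apply: open_nbhs_nbhs; split;
    [exact: (open_act_preimage act_homeo)|exact: set_mem].
  - by apply: open_nbhs_nbhs; split;
    [exact: (open_act_preimage act_homeo)|exact: set_mem].
have [AB ABP] := choice sep.
pose P := [set y | (forall i, O (act (h i) y)) /\
  forall p : 'I_n * 'I_n, p.1 != p.2 ->
    (AB p).1 (act (h p.1) y) /\ (AB p).2 (act (h p.2) y)].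
have nP : nbhs x P.
  apply: filterI.
    apply: filter_forall => i; apply: open_nbhs_nbhs; split; last exact: hO.
    exact: (open_act_preimage act_homeo).
  apply: filter_forall => p; have [e|ne] := eqVneq p.1 p.2.
    by apply: filterE => y; rewrite e.
  have [H1 H2 _] := ABP p ne.
  by apply: filterS2 H1 H2 => y ? ? _.
exists h, P°; split=> //.
- exact: open_interior.
- by move=> i y /interior_subset[+ _]; exact.
- move=> i j y y' /interior_subset[_ Py] /interior_subset[_ Py'] e.
  apply/eqP; apply: contrapT => /negP ne.
  have [_ _ AB0] := ABP (i, j) ne.
  have [/= A1 _] := Py (i, j) ne; have [/= _ B1] := Py' (i, j) ne.
  have : ((AB (i, j)).1 `&` (AB (i, j)).2) (act (h i) y) by split; rewrite // e.
  by rewrite AB0.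
Qed.

End comparison.

Section null_comparison.
Variables (R : realType) (G : groupType) (X : pmetricType R).
Variables (act : G -> X -> X) (sd : strands G).
Hypotheses (X_compact : compact [set: X]) (act_homeo : action_by_homeo act).
Hypotheses (X_inf : infinite_set [set: X]) (act_min : minimal_action act).
Let z := zpow sd.
Let T := act (z 1).

Lemma birkhoff_mul_ge (v : X -> R) (kappa : R) M q x :
  (forall y, kappa <= birkhoff T v M y) ->
    kappa * q%:R <= birkhoff T v (q * M) x.
Proof.
move=> H; elim: q x => [|q IH] x.
  by rewrite mulr0 mul0n /birkhoff big_ord0.
by rewrite mulSn birkhoffD mulrS mulrDr mulr1 lerD.
Qed.

(** A single b-orbit may miss the support of [u], but its finitely many
    translates by coset representatives together are a whole orbit of the
    group; hence the average over the representatives. *)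
Lemma birkhoff_lower_bound (u : X -> R) x0 : continuous u -> 0 < u x0 ->
  (forall x, 0 <= u x) ->
  exists (kappa : R) (M : nat), [/\ 0 < kappa, (0 < M)%N &
    forall x, kappa <= birkhoff T
      (fun y => (size (reps sd))%:R^-1 * \sum_(r <- reps sd) u (act r y)) M x].
Proof.
move=> cu u0 u_ge0; set c := (size (reps sd))%:R^-1.
have c0 : 0 < c :> R by rewrite invr_gt0 ltr0n reps_gt0.
pose O := [set y | u x0 / 2 < u y].
have oO : open O by apply: open_comp (@open_gt _ (u x0 / 2)) => y _; exact: cu.
have O0 : O !=set0 by exists x0; rewrite /O /= ltr_pdivrMr // ltr_pMr // ltr1n.
have [D DX] : exists D : {fset G},
    forall y, exists2 g, g \in D & (act g @^-1` O) y.
  apply: finite_subcover => // [g|y]; first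
    exact: (open_act_preimage act_homeo).
  exact: (orbit_meets y act_min oO O0).
pose H := \max_(g <- D) `|height sd g|%N.
exists (c * (u x0 / 2)), (H + H).+1; split=> //.
  by rewrite mulr_gt0 // divr_gt0.
move=> x; have [g gD Og] := DX (act (z H%:Z) x).
have [k [kH kE]] : exists k : nat, (k <= H + H)%N /\ height sd g + H%:Z = k%:Z.
  have : (`|height sd g| <= H)%N by rewrite /H (big_rem g) //= leq_maxl.
  by move: (height sd g) => a aH; exists (absz (a + H%:Z)%R); lia.
rewrite /birkhoff (bigD1 (Ordinal (kH : (k < (H + H).+1)%N))) //=.
rewrite (iter_zpow act_homeo) -/z.
have u_sum y : 0 <= c * \sum_(r <- reps sd) u (act r y).
  by rewrite mulr_ge0 ?(ltW c0) // sumr_ge0.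
rewrite -[leLHS]addr0 lerD ?sumr_ge0 // ler_pM2l //.
rewrite (big_rem (rep sd g)) ?rep_mem //= -[leLHS]addr0 lerD ?sumr_ge0 //.
apply: ltW; move: Og; rewrite /O /= {1}(rep_height sd g) -!actM //.
by rewrite -mulgA -zpowD kE.
Qed.

(** The server at [y] can use the capacity of any [act r y], [r] a
    representative, so one point of the open set could be claimed by several
    b-orbits. To prevent this the capacity is supported on a small set [B]
    having as many disjoint translates [h i B] inside [O] as there are
    representatives, and the claim made through the [i]-th representative is
    redirected by [h i]. *)
Theorem null_subequiv (C O : set X) : closed C -> invariant_null act C ->
  open O -> O !=set0 -> dyn_subequiv act C O.
Proof.
move=> cC nullC oO O0.
pose c := size (reps sd).
have [x0 _] := O0.
have [h [B [oB Bx0 hO h_disj]]] :=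
  @disjoint_translates R G X act X_compact act_homeo X_inf act_min O x0 c oO O0.
have sep : uniform_separator (~` B) [set x0].
  apply: normal_uniform_separator => //.
  - by apply: compact_normal => //; exact: metric_hausdorff.
  - exact: open_closedC.
  - by apply: accessible_closed_set1; apply: hausdorff_accessible;
    exact: metric_hausdorff.
  - by apply/seteqP; split=> y // [nB e]; apply: nB; rewrite e.
have [u [cu u01 u0 u1]] := (@uniform_separatorP _ R _ _).1 sep.
have u01' y : 0 <= u y <= 1 by have := u01 (u y); rewrite /= in_itv /=; apply;
  exists y.
have uB y : 0 < u y -> B y.
  move=> uy; apply: contrapT => nB; move: uy.
  by rewrite (u0 (u y)) ?ltxx //; exists y.
have ux0 : u x0 = 1 by apply: u1; exists x0.
have [||kappa [M [k0 M0 kM]]] := @birkhoff_lower_bound u x0 cu.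
- by rewrite ux0.
- by move=> x; case/andP: (u01' x).
set v := fun y => _ in kM.
have c0 : 0 < c%:R :> R by rewrite ltr0n reps_gt0.
have v01 y : 0 <= v y <= 1.
  rewrite /v mulr_ge0 ?invr_ge0 ?(ltW c0) //=; last first.
    by apply: sumr_ge0 => r _; case/andP: (u01' (act r y)).
  rewrite mulrC ler_pdivrMr // mul1r.
  apply: (@le_trans _ _ (\sum_(r <- reps sd) 1)).
    by apply: ler_sum => r _; case/andP: (u01' (act r y)).
  by rewrite big_const_seq count_predT iter_addr addr0.
have cv : continuous v.
  have csum rs : continuous (fun x => \sum_(r <- rs) u (act r x)).
    elim: rs => [|r rs IH].
      have -> : (fun x => \sum_(r <- [::]) u (act r x)) = cst 0.
        by apply/funext => x; rewrite big_nil.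
      by move=> y; exact: cvg_cst.
    have -> : (fun x => \sum_(i <- r :: rs) u (act i x)) =
        (u \o act r) \+ (fun x => \sum_(i <- rs) u (act i x)).
      by apply/funext => x; rewrite big_cons.
    move=> y; apply: cvgD; last exact: IH.
    by apply: continuous_comp; [exact: act_continuous|exact: cu].
  by move=> y; apply: cvgM; [exact: cvg_cst|exact: csum].
have v_gt0 y : 0 < v y -> exists i : 'I_c, 0 < u (act (nth 1%g (reps sd) i) y).
  move=> vy; apply: contrapT => none; move: vy;
    rewrite /v big_seq big1 ?mulr0 ?ltxx //.
  move=> r rin; apply/eqP; apply: contrapT => /negP ne; apply: none.
  have lt : (index r (reps sd) < c)%N by rewrite index_mem.
  exists (Ordinal lt) => /=; rewrite nth_index // lt_def ne.
  by case/andP: (u01' (act r y)).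
(* small enough for the tripled weight below to be outweighed by v *)
have d0 : 0 < kappa / (3 * M%:R) by rewrite divr_gt0 // mulr_gt0 // ltr0n.
have [n [w0 [n0 /dvdnP[q nE] cw0 w01 [w0C w0n]]]] :=
  invariant_null_average sd X_compact act_homeo cC nullC d0 M0.
pose w y := 3 * w0 y.
have cw : continuous w by move=> y; apply: cvgM; [exact: cvg_cst|exact: cw0].
have w03 y : 0 <= w y <= 3 by rewrite /w; have := w01 y; lra.
have wv y : birkhoff T w n y <= birkhoff T v n y.
  have -> : birkhoff T w n y = 3 * birkhoff T w0 n y
    by rewrite /birkhoff mulr_sumr.
  rewrite nE; apply: le_trans (birkhoff_mul_ge q y kM); rewrite -nE.
  apply: (@le_trans _ _ (3 * (kappa / (3 * M%:R) * n%:R))); first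
    by rewrite ler_pM2l.
  by rewrite nE natrM le_eqVlt; apply/orP; left; apply/eqP; field;
    rewrite gt_eqF // ltr0n.
pose N := ((Num.truncn ((3 * n%:R + 1) / kappa)).+1 * M)%N.
have vN y : 3 * n%:R + 1 < birkhoff T v N y.
  apply: lt_le_trans (birkhoff_mul_ge _ y kM).
  by rewrite [kappa * _]mulrC -ltr_pdivrMr // truncnS_gt.
have cT g : continuous (act g) by exact: act_continuous.
have [V [oV CV Vv Vinj]] := fifo_matching (cT (z 1)) (cT (z 1)^-1%g)
  (actK act_homeo _) (actKV act_homeo _) cw cv w03 v01 n0 wv vN.
pose r (i : 'I_c) := nth 1%g (reps sd) i.
have itE (s : nat) y : iter s T y = act (z s%:Z) y by exact: iter_zpow.
apply: (@dyn_subequiv_fin R G X act ('I_N * 'I_c)%type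
  (fun p => V p.1 `&` [set y | 0 < u (act (r p.2) (iter p.1 T y))])
  (fun p => (h p.2 * (r p.2 * z p.1%:Z))%g)).
- move=> [s i] /=; apply: openI => //.
  have -> : [set y | 0 < u (act (r i) (iter s T y))] =
      (act (r i * z s%:Z)%g) @^-1` (u @^-1` [set t | 0 < t]).
    by apply/seteqP; split=> y /=; rewrite actM // itE.
  by apply: open_act_preimage => //; apply: open_comp (@open_gt _ 0) => y _;
    exact: cu.
- move=> y Cy; have [|s _ Vs] := CV y; first by rewrite /= /w w0C // mulr1.
  by have [i ui] := v_gt0 _ (Vv s y Vs); exists (s, i).
- move=> [s i] [t j] y y' [/= Vs us] [/= Vt ut].
  rewrite !actM // -!itE => e.
  have ij := h_disj _ _ _ _ (uB _ us) (uB _ ut) e.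
  subst j; move: e => /(act_inj act_homeo)/(act_inj act_homeo).
  by move=> /(Vinj _ _ _ _ Vs Vt)[-> _].
- by move=> [s i] y [/= Vs us]; rewrite !actM // -itE; apply: hO; exact: uB.
Qed.

End null_comparison.

(** * Voronoi cells in the group *)

Section voronoi.
Variables (G : groupType) (sd : strands G).
Let z := zpow sd.
Let h := height sd.
Let rp := rep sd.
Let rs := reps sd.

Lemma height_reps r k : r \in rs -> h (r * z k)%g = k.
Proof.
move=> rin; rewrite /h height_zpow; suff -> : height sd r = 0 by rewrite add0r.
have e := rep_height sd r; have := height_zpow sd r (height sd r).
rewrite (rep_id rin) in e; rewrite -e => /eqP.
by rewrite -[X in X == _]addr0 (inj_eq (addrI _)) eq_sym => /eqP.
Qed.

Definition slab (a : int) (n : nat) : {fset G} :=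
  [fset g in [seq (r * z (a + k%:Z)%R)%g | r <- rs, k <- iota 0 n]]%fset.

Lemma mem_slab a n g : (g \in slab a n) = (a <= h g < a + n%:Z).
Proof.
rewrite in_fset /=; apply/allpairsP/idP => [[[r k] /= [rin]]|/andP[ag ga]].
  rewrite mem_iota /= add0n => kn ->; rewrite (height_reps _ rin); lia.
exists (rp g, absz (h g - a)) => /=; split; first exact: rep_mem.
  by rewrite mem_iota /= add0n; lia.
by rewrite [LHS](rep_height sd g); congr (_ * z _)%g; rewrite -/h; lia.
Qed.

Lemma card_slab a n : #|` slab a n| = (size rs * n)%N.
Proof.
rewrite card_fseq undup_id ?size_allpairs ?size_iota //.
apply: allpairs_uniq; [exact: reps_uniq|exact: iota_uniq|].
move=> _ _ /allpairsP[[r k] /= [rin _ ->]] /allpairsP[[r' k'] /= [rin' _ ->]]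
  /= e.
have := congr1 h e; rewrite !height_reps // => /addrI[->].
have := congr1 rp e; rewrite /rp /z !rep_zpow rep_id // rep_id //.
by move=> ->.
Qed.

(** An injective enumeration of the group refining the order by absolute
    height. *)
Definition strand_code (g : G) : nat :=
  (`|h g| * (size rs * 2) + (index (rp g) rs * 2 + (h g < 0)%R))%N.

Lemma strand_code_offset g :
  (index (rp g) rs * 2 + (h g < 0)%R < size rs * 2)%N.
Proof.
have : (index (rp g) rs < size rs)%N by rewrite index_mem; exact: rep_mem.
by move: (index _ _) (size _) => i s; case: (h g < 0)%R; lia.
Qed.

Lemma strand_code_lt g g' :
  (`|h g| < `|h g'|)%N -> (strand_code g < strand_code g')%N.
Proof.
move=> lt; have := strand_code_offset g; rewrite /strand_code.
move=> oc; apply: (@leq_trans (`|h g|.+1 * (size rs * 2))%N).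
  by rewrite mulSnr ltn_add2l.
by apply: leq_trans (leq_addr _ _); rewrite leq_mul2r lt orbT.
Qed.

Lemma strand_code_inj : injective strand_code.
Proof.
move=> g g' e.
have hh : `|h g|%N = `|h g'|%N.
  have [/strand_code_lt|/strand_code_lt|//] := ltngtP `|h g|%N `|h g'|%N;
    rewrite e ltnn //.
have [hg ig] : h g = h g' /\ index (rp g) rs = index (rp g') rs.
  move: e; rewrite /strand_code hh => /addnI.
  by case: ltP => h0; case: ltP => h1; lia.
rewrite (rep_height sd g) (rep_height sd g') -/h hg.
have := congr1 (nth 1%g rs) ig; rewrite !nth_index; [|exact: rep_mem..].
by rewrite /rp => ->.
Qed.

(** The representatives can be collected on the left at the price of
    conjugating a power of the generator, which at most reverses its sign. *)
Lemma height_divg : exists A : nat, forall g p,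
  (`|h (g * p^-1)%g| <= absz (h g - h p)%R + A)%N /\
  (absz (h g - h p)%R <= `|h (g * p^-1)%g| + A)%N.
Proof.
exists (\max_(r <- rs) \max_(s <- rs) `|h (r * s^-1)%g|)%N => g p.
have le : (`|h (rp g * (rp p)^-1)%g| <=
    \max_(r <- rs) \max_(s <- rs) `|h (r * s^-1)%g|)%N.
  rewrite (big_rem (rp g)) ?rep_mem //= (big_rem (rp p)) ?rep_mem //=.
  by rewrite -maxnA leq_maxl.
suff : h (g * p^-1)%g = h (rp g * (rp p)^-1)%g + (h g - h p) \/
       h (g * p^-1)%g = h (rp g * (rp p)^-1)%g - (h g - h p).
  by move: le; move: (\max_(_ <- _) _)%N => A le [] ->; lia.
have E : (g * p^-1 = rp g * (rp p)^-1 * (rp p * z (h g - h p)%R * (rp p)^-1))%g.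
  rewrite {1}(rep_height sd g) {1}(rep_height sd p) invgM !mulgA mulgVK.
  congr (_ * _)%g; rewrite -!mulgA; congr (_ * _)%g.
  by rewrite /z zpowD (morphN (zpowD sd)).
rewrite E /z; have [e|e] := zpow_conj sd (rp p); [left|right];
  by rewrite e /h height_zpow.
Qed.

Lemma height_mull (K : {fset G}) : exists M : nat, forall k g, k \in K ->
  (absz (h (k * g)%g - h g)%R <= M)%N.
Proof.
exists (\max_(k <- K) \max_(s <- rs) `|h (k * s)%g|)%N => k g kK.
rewrite {1}(rep_height sd g) mulgA /h height_zpow addrK.
by rewrite (big_rem k) //= (big_rem (rep sd g)) ?rep_mem //= -maxnA leq_maxl.
Qed.

(* S is the Voronoi cell of the identity for the set P of visits *)
Variables (P : G -> Prop) (S : {fset G}) (L : nat).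
Hypothesis SP : forall g, g \in S <->
  forall p, P p -> (strand_code g <= strand_code (g * p^-1)%g)%N.
Hypothesis PL : forall p, P p -> p != 1%g -> (L < `|h p|)%N.

Section cell.
Variable A : nat.
Hypothesis hA : forall g p,
  (`|h (g * p^-1)%g| <= absz (h g - h p)%R + A)%N /\
  (absz (h g - h p)%R <= `|h (g * p^-1)%g| + A)%N.
Hypothesis AL : (A <= L)%N.

(** As the cell is finite, an element far out in the direction [e] must be
    closer to another visit, and this visit lies in the same direction. *)
Lemma cell_neighbour (e : int) : e = 1 \/ e = -1 -> exists t : nat,
  [/\ (L < t)%N, exists2 p, P p & h p = e * t%:Z &
   forall p, P p -> p != 1%g -> 0 < e * h p -> t%:Z <= e * h p].
Proof.
move=> e1.
pose Q t := `[< exists p, [/\ P p, p != 1%g & h p = e * t.+1%:Z] >].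
have exQ : exists t, Q t.
  pose N := (\max_(g <- S) `|h g|).+1%N.
  have r1 : rp 1%g \in rs by exact: rep_mem.
  pose g := (rp 1 * z (e * N%:Z)%R)%g.
  have hg : h g = e * N%:Z by exact: height_reps.
  have gS : g \notin S.
    apply/negP => gS; have : (`|h g| <= \max_(g <- S) `|h g|)%N.
      by rewrite (big_rem g) //= leq_maxl.
    by rewrite hg -ltnS -/N; case: e1 => ->; lia.
  have [p Pp lt] : exists2 p,
    P p & (strand_code (g * p^-1)%g < strand_code g)%N.
    apply: contrapT => none; move/negP: gS; apply; apply/SP => p Pp.
    by rewrite leqNgt; apply/negP => lt; apply: none; exists p.
  have p1 : p != 1%g by apply: contraTN lt => /eqP ->; rewrite invg1 mulg1 ltnn.
  have := PL Pp p1 => Lp.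
  have le : (`|h (g * p^-1)%g| <= `|h g|)%N.
    by rewrite leqNgt; apply/negP => /strand_code_lt; rewrite ltnNge (ltnW lt).
  have [_ le2] := hA g p; rewrite hg in le le2.
  exists (`|h p|.-1)%N; apply/asboolP; exists p; split=> //.
  move: AL le le2 Lp; move: (h p) (h (g * p^-1)%g) (N) => a b N'.
  by case: e1 => ->; lia.
case: (ex_minnP exQ) => t /asboolP[p [Pp p1 pt]] mint; exists t.+1; split.
- by have := PL Pp p1; rewrite pt; case: e1 => ->; lia.
- by exists p.
- move=> p' Pp' p1' pos; have : (t <= (`|h p'|).-1)%N.
    apply: mint; apply/asboolP; exists p'; split=> //.
    by move: pos; have := PL Pp' p1'; case: e1 => ->; lia.
  by move: pos; case: e1 => ->; lia.
Qed.

(** Up to [A] the height of a quotient is the difference of the heights, so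
    membership is decided by comparison with the two nearest visits. *)
Lemma cell_sandwich : exists tp tm : nat, [/\ (L < tp)%N, (L < tm)%N,
  forall g, 2 * h g + A%:Z < tp%:Z -> - 2 * h g + A%:Z < tm%:Z -> g \in S &
  forall g, g \in S -> 2 * h g <= tp%:Z + A%:Z /\ - 2 * h g <= tm%:Z + A%:Z].
Proof.
have [tp [Ltp [pp Ppp hpp] tpP]] := cell_neighbour (or_introl (erefl 1)).
have [tm [Ltm [pm Ppm hpm] tmP]] := cell_neighbour (or_intror (erefl (- 1))).
exists tp, tm; split=> // [g gp gm|g gS].
  apply/SP => p Pp; have [->|p1] := eqVneq p 1%g; first by rewrite invg1 mulg1.
  apply/ltnW/strand_code_lt; have := PL Pp p1; have [_] := hA g p.
  have := tpP p Pp p1; have := tmP p Pp p1.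
  move: AL Ltp Ltm gp gm; move: (h g) (h p) (h (g * p^-1)%g) => a b c; lia.
have cle p : P p -> (`|h g| <= `|h (g * p^-1)%g|)%N.
  move=> Pp; rewrite leqNgt; apply/negP => /strand_code_lt.
  by move/SP: gS => /(_ p Pp); rewrite leqNgt => /negP.
have := cle pp Ppp; have := cle pm Ppm.
have [le1 _] := hA g pp; have [le2 _] := hA g pm.
move: le1 le2; rewrite hpp hpm; move: AL Ltp Ltm.
move: (h g) (h (g * pp^-1)%g) (h (g * pm^-1)%g) => a b c; lia.
Qed.

End cell.
End voronoi.

Section voronoi_folner.
Variables (R : realType) (G : groupType) (sd : strands G).
Let h := height sd.

(** Multiplication on the left by [K] changes heights by at most [M]. So the
    elements pushed out of the cell have heights in two windows of length
    about [A + M], one at each end, whereas the cell itself contains all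
    elements of height from [0] to [m - 1]. *)
Lemma voronoi_folner (K : {fset G}) (eps : R) (n : nat) : 0 < eps ->
  exists L : nat, forall (P : G -> Prop) (S : {fset G}),
    (forall g, g \in S <->
       forall p, P p -> (strand_code sd g <= strand_code sd (g * p^-1)%g)%N) ->
    (forall p, P p -> p != 1%g -> (L < `|h p|)%N) ->
    folner K eps S /\ (n < #|` S|)%N.
Proof.
move=> e0; have [A hA] := height_divg sd; have [M hM] := height_mull sd K.
pose c := size (reps sd).
have c0 : (0 < c)%N by exact: reps_gt0.
pose m := maxn n.+1 (Num.truncn ((2 * (A + M + 2))%:R / eps)).+1.
exists (2 * m + A)%N => P S SP PL.
have [tp [tm [Ltp Ltm Sin Sout]]] :=
  cell_sandwich SP PL hA (leq_addl (2 * m) A).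
have lbS : (c * m <= #|` S|)%N.
  rewrite -(card_slab sd 0 m); apply: fsubset_leq_card; apply/fsubsetP => g.
  by rewrite mem_slab => /andP[g0 gm]; apply: Sin; rewrite -/h in g0 gm *; lia.
split; last first.
  apply: leq_trans lbS; apply: (@leq_trans m); first by rewrite leq_maxl.
  by rewrite leq_pmull.
pose w := (A + M + 2)%N.
pose a1 := ((tp%:Z - A%:Z) %/ 2)%Z.
pose a2 := - ((tm%:Z + A%:Z) %/ 2)%Z - M%:Z.
have sub : ([fset (k * s)%g | k in K, s in S] `\` S `<=`
    slab sd a1 w `|` slab sd a2 w)%fset.
  apply/fsubsetP => _ /fsetDP[/imfset2P[k kK [g gS ->]] nS].
  have := hM k g kK; have [] := Sout g gS.
  have : ~ (2 * h (k * g)%g + A%:Z < tp%:Z /\ - 2 * h (k * g)%g + A%:Z < tm%:Z).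
    by move=> [? ?]; move/negP: nS; apply; exact: Sin.
  rewrite in_fsetU !mem_slab -/h /a1 /a2 /w.
  move: (h (k * g)%g) (h g) => x y; lia.
have ubT :
    (#|` ([fset (k * s)%g | k in K, s in S] `\` S)%fset| <= c * (2 * w))%N.
  apply: leq_trans (fsubset_leq_card sub) _;
    apply: leq_trans (leq_card_fsetU _ _) _.
  by rewrite !card_slab -/c; lia.
rewrite /folner; apply: (@le_lt_trans _ _ (c * (2 * w))%:R).
  by rewrite ler_nat.
apply: (@lt_le_trans _ _ (eps * (c * m)%:R)); last first.
  by rewrite ler_pM2l // ler_nat.
rewrite natrM [in ltRHS]natrM mulrCA ltr_pM2l ?ltr0n // mulrC -ltr_pdivrMr //.
apply: lt_le_trans (truncnS_gt _) _.
by rewrite ler_nat leq_maxr.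
Qed.

End voronoi_folner.

(** * The castle *)

Section null_sets.
Variables (R : realType) (G : groupType) (X : pmetricType R).
Variable act : G -> X -> X.
Hypothesis act_homeo : action_by_homeo act.

Definition closed_null (A : set X) := closed A /\ invariant_null act A.

Lemma closed_null0 : closed_null set0.
Proof. by split; [exact: closed0|move=> mu _; exact: measure0]. Qed.

Lemma closed_null_sub A B : closed A -> A `<=` B -> closed_null B ->
  closed_null A.
Proof.
move=> cA AB [cB nB]; split=> // mu inv.
apply/eqP; rewrite eq_le measure_ge0 andbT.
rewrite -(nB mu inv); apply: le_measure => //; rewrite inE; exact: closed_borel.
Qed.

Lemma closed_nullU A B : closed_null A -> closed_null B ->
  closed_null (A `|` B).
Proof.
move=> [cA nA] [cB nB]; split; first exact: closedU.
move=> mu inv; apply/eqP; rewrite eq_le measure_ge0 andbT.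
have := @measureU2 _ _ _ mu A B (closed_borel cA) (closed_borel cB).
move/le_trans; apply.
rewrite le_eqVlt; apply/orP; left; apply/eqP.
etransitivity.
  exact: (congr2 (fun a b => a + b)%E (nA mu inv) (nB mu inv)).
exact: adde0.
Qed.

Lemma closed_null_preimage g A : closed_null A -> closed_null (act g @^-1` A).
Proof.
move=> [cA nA]; split.
  by apply: closed_comp => // x _; exact: (act_continuous act_homeo).
by move=> mu inv; have -> := inv g A (closed_borel cA); exact: nA.
Qed.

Lemma closed_null_bigcup (I : choiceType) (s : seq I) (F : I -> set X) :
  (forall i, i \in s -> closed_null (F i)) ->
    closed_null (\bigcup_(i in [set` s]) F i).
Proof.
elim: s => [|i s IH] H.
  rewrite (_ : \bigcup_(_ in _) _ = set0); first exact: closed_null0.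
  by rewrite -subset0 => x [].
have -> : \bigcup_(j in [set` i :: s]) F j =
    F i `|` \bigcup_(j in [set` s]) F j.
  apply/seteqP; split=> x.
    move=> [j /= js Fx]; move: js; rewrite inE => /predU1P[<-|js]; first
      by left.
    by right; exists j.
  by move=> [Fx|[j js Fx]]; [exists i|exists j] => //=;
    rewrite inE ?eqxx // js orbT.
apply: closed_nullU; first by apply: H; rewrite mem_head.
by apply: IH => j js; apply: H; rewrite inE js orbT.
Qed.

End null_sets.

Section generic.
Variables (R : realType) (G : groupType) (X : pmetricType R).
Variable act : G -> X -> X.
Hypothesis act_homeo : action_by_homeo act.
Hypothesis act_free : topologically_free act.

Lemma generic_point (s : seq G) :
  exists x, forall g, g \in s -> g != 1%g -> act g x <> x.
Proof.
suff : exists U : set X, [/\ open U, U !=set0 &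
    forall g x, g \in s -> g != 1%g -> U x -> act g x <> x].
  by move=> [U [_ [x Ux] H]]; exists x => g gs g1; exact: H.
elim: s => [|g s [U [oU U0 HU]]].
  by exists setT; split=> //; [exact: openT|exists point].
have [->|g1] := eqVneq g 1%g.
  exists U; split=> // g' x; rewrite inE => /predU1P[->|]; first
    by rewrite eqxx.
  exact: HU.
have [y [Uy ny]] : (U `\` closure [set x | act g x = x]) !=set0.
  apply/set0P/eqP => e; have [y Uy] := U0.
  suff : (closure [set x | act g x = x])° y by rewrite (act_free g1).
  apply: (@filterS _ _ _ U); last by apply: open_nbhs_nbhs.
  move=> x Ux; apply: contrapT => nx.
  by have : (U `\` closure [set x | act g x = x]) x by []; rewrite e.
exists (U `\` closure [set x | act g x = x]); split.
- by apply: open_setD => //; exact: closed_closure.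
- by exists y.
- move=> g' x; rewrite inE => /predU1P[->|gs] g1' [Ux nx].
    by move=> e; apply: nx; exact: subset_closure.
  exact: HU.
Qed.

Lemma separating_nbhd (s : seq G) x :
  (forall g, g \in s -> g != 1%g -> act g x <> x) ->
  exists U : set X, [/\ open U, U x &
    forall g y, g \in s -> g != 1%g -> U y -> ~ U (act g y)].
Proof.
elim: s => [|g s IH] H; first by exists setT; split=> //; exact: openT.
have [|U [oU Ux HU]] := IH; first by move=> g' gs; apply: H;
  rewrite inE gs orbT.
have [g1|g1] := eqVneq g 1%g.
  exists U; split=> // g' y; rewrite inE => /predU1P[->|]; first
    by rewrite g1 eqxx.
  exact: HU.
have ne : x != act g x by apply/eqP => e; apply: (H g _ g1); rewrite ?mem_head.
have := @metric_hausdorff _ X; rewrite open_hausdorff => /(_ _ _ ne).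
move=> [[A B] /= [Ax Bx] [oA oB /eqP AB0]].
exists (U `&` (A `&` act g @^-1` B)); split.
- by apply: openI => //; apply: openI => //; exact: open_act_preimage.
- by split=> //; split; exact: set_mem.
- move=> g' y; rewrite inE => /predU1P[->|gs] g1' [Uy [Ay By]] [Ugy [Agy _]].
    by have : (A `&` B) (act g y) by []; rewrite AB0.
  exact: (HU g' y).
Qed.

End generic.

Section castle.
Variables (R : realType) (G : groupType) (X : pmetricType R).
Variables (act : G -> X -> X) (sd : strands G).
Hypotheses (X_compact : compact [set: X]) (act_homeo : action_by_homeo act).
Hypothesis act_min : minimal_action act.
Variable V : set X.
Hypotheses (oV : open V) (V0 : V !=set0).

(** The injective enumeration makes the element attached to [x] unique, so
    this is a Voronoi assignment along orbits without ties. *)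
Definition nearest g x := V (act g^-1%g x) /\
  forall g', V (act g'^-1%g x) -> (strand_code sd g <= strand_code sd g')%N.

Lemma nearest_exists x : exists g, nearest g x.
Proof.
pose Q k := `[< exists2 g, V (act g^-1%g x) & strand_code sd g = k >].
have exQ : exists k, Q k.
  have [g Vg] := orbit_meets x act_min oV V0.
  by exists (strand_code sd g^-1%g); apply/asboolP; exists g^-1%g;
    rewrite ?invgK.
case: (ex_minnP exQ) => k /asboolP[g Vg gk] mink; exists g; split=> // g' Vg'.
by rewrite gk; apply: mink; apply/asboolP; exists g'.
Qed.

Lemma nearest_uniq g g' x : nearest g x -> nearest g' x -> g = g'.
Proof.
move=> [Vg Hg] [Vg' Hg']; apply: (@strand_code_inj _ sd); apply/eqP.
by rewrite eqn_leq Hg // Hg'.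
Qed.

Lemma nearest_bounded :
  exists D : nat, forall g x, nearest g x -> (strand_code sd g <= D)%N.
Proof.
have [D DX] : exists D : {fset G},
    forall y, exists2 g, g \in D & (act g @^-1` V) y.
  apply: finite_subcover => // [g|y]; first
    exact: (open_act_preimage act_homeo).
  exact: (orbit_meets y act_min oV V0).
exists (\max_(g <- D) strand_code sd g^-1%g) => g x [_ Hg].
have [g' g'D Vg'] := DX x.
apply: (leq_trans (Hg g'^-1%g _)); first by rewrite invgK.
by rewrite (big_rem g') //= leq_maxl.
Qed.

Definition height_ball n : {fset G} := slab sd (- n%:Z) (n + n).+1.

Lemma mem_height_ball n g : (g \in height_ball n) = (`|height sd g| <= n)%N.
Proof. by rewrite mem_slab; lia. Qed.

Lemma height_le_strand_code g : (`|height sd g| <= strand_code sd g)%N.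
Proof.
rewrite /strand_code; apply: leq_trans (leq_addr _ _).
by rewrite leq_pmulr // muln_gt0 reps_gt0.
Qed.

Definition cell (E : {fset G}) (y : X) : {fset G} :=
  [fset g in E | `[< nearest g (act g y) >]]%fset.

Lemma mem_cell E y g : g \in cell E y -> nearest g (act g y).
Proof. by rewrite !inE => /andP[_ /asboolP]. Qed.

Lemma nearest_in_cell E y g : g \in E -> nearest g (act g y) -> g \in cell E y.
Proof. by rewrite !inE => -> ng; apply/asboolP. Qed.

(** The element of the cell is recovered from the point of the level: this
    is the disjointness of the castle, valid at points with nontrivial
    stabiliser too. *)
Lemma cell_disjoint E y y' g g' : g \in cell E y -> g' \in cell E y' ->
  act g y = act g' y' -> g = g' /\ y = y'.
Proof.
move=> /mem_cell ng /mem_cell ng' e; rewrite -e in ng'.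
have gg := nearest_uniq ng ng'; split=> //; subst g'.
exact: (act_inj act_homeo e).
Qed.

(** Replacing [y] by [act p y] multiplies its visits by [p^-1] on the right;
    this brings the cell to the form studied in [voronoi_folner]. *)
Lemma cellP E y g : (forall g x, nearest g x -> g \in E) -> V y ->
  (g \in cell E y) <->
  forall p, V (act p y) -> (strand_code sd g <= strand_code sd (g * p^-1)%g)%N.
Proof.
move=> nE Vy; split.
  move=> /mem_cell[_ H] p Vp; apply: H.
  by rewrite invgM invgK actM // (actK act_homeo).
move=> H; suff ng : nearest g (act g y).
  by rewrite !inE (nE _ _ ng) /=; apply/asboolP.
split; first by rewrite (actK act_homeo).
move=> g' Vg'; have := H (g'^-1 * g)%g; rewrite actM // => /(_ Vg').
by rewrite invgM invgK mulVKg.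
Qed.

(** Only elements of [E] compete with elements preceding them in the
    enumeration, so the cell depends on finitely many visits only and is
    locally constant away from finitely many translates of the boundary of
    [V]. *)
Lemma cell_local E : exists W : {fset G}, forall y y',
  (forall w, w \in W -> V (act w y') <-> V (act w y)) -> cell E y' = cell E y.
Proof.
pose N := \max_(g <- E) strand_code sd g.
exists [fset (h^-1 * g)%g | h in height_ball N, g in E]%fset => y y' H.
have nearest_sub g u u' : g \in E ->
    (forall w, w \in [fset (h^-1 * g)%g | h in height_ball N, g in E]%fset ->
       V (act w u') <-> V (act w u)) ->
    nearest g (act g u) -> nearest g (act g u').
  move=> gE Hu [Vg ming].
  have gN : (strand_code sd g <= N)%N by rewrite /N (big_rem g) //= leq_maxl.
  have HV h : (strand_code sd h <= N)%N ->
      V (act h^-1%g (act g u')) <-> V (act h^-1%g (act g u)).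
    move=> hN; rewrite -!actM //; apply: Hu; apply: in_imfset2 => //=.
    by rewrite mem_height_ball (leq_trans (height_le_strand_code h)).
  split; first by apply/HV.
  move=> h Vh; rewrite leqNgt; apply/negP => lt.
  have hN : (strand_code sd h <= N)%N by apply: leq_trans gN; exact: ltnW.
  by move/(HV h hN): Vh => /ming; rewrite leqNgt lt.
apply/fsetP => g; rewrite !inE; case gE : (g \in E) => //=.
apply/asboolP/asboolP; last exact: (nearest_sub g y y').
by apply: (nearest_sub g y' y) => // w wW; apply: iff_sym; exact: H.
Qed.

End castle.

Section castle_construction.
Variables (R : realType) (G : groupType) (X : pmetricType R).
Variables (act : G -> X -> X) (sd : strands G).
Hypotheses (X_compact : compact [set: X]) (act_homeo : action_by_homeo act).
Hypotheses (act_min : minimal_action act) (act_free : topologically_free act).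
Hypothesis sbp : small_boundary_property act.

Lemma open_levels (I : finType) (S : I -> {fset G}) (B : I -> set X) :
  (forall i, open (B i)) -> open (levels act S B).
Proof.
move=> oB; apply: bigcup_open => i _; apply: bigcup_open => s _.
exact: open_act_image.
Qed.

(** The bases are the interiors of the sets of points of [V] with a
    prescribed cell and a prescribed trace on a cover by small sets with
    null boundary; these data are locally constant off a finite union of
    translates of boundaries. Only cells that are Foelner and large are used
    as indices, and these are all the cells that occur. *)
Proposition castle_null_remainder (K : {fset G}) (n : nat) (eps : R) :
  0 < eps ->
  exists (I : finType) (S : I -> {fset G}) (B : I -> set X),
    [/\ open_castle act S B,
        forall i, folner K eps (S i) /\ (n < #|` S i|)%N,
        forall i s, s \in S i -> (diam (act s @` B i) < eps%:E)%E
      & invariant_null act (~` levels act S B)].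
Proof.
move=> eps0.
have [L LP] := voronoi_folner sd K n eps0.
have [x0 x0P] := generic_point act_free (height_ball sd L).
have [U0 [oU0 U0x0 U0P]] := separating_nbhd act_homeo x0P.
have [V [oV Vx0 VU0 Vnull]] := sbp oU0 U0x0.
have V0 : V !=set0 by exists x0.
have closed_nullV : closed_null act (boundary V) by split;
  [exact: closed_boundary|].
have [D DP] := nearest_bounded sd X_compact act_homeo act_min oV V0.
pose E := height_ball sd D.
have nE g x : V (act g^-1%g x) /\ (forall g', V (act g'^-1%g x) ->
    (strand_code sd g <= strand_code sd g')%N) -> g \in E.
  by move=> /DP; rewrite mem_height_ball; apply: leq_trans;
    exact: height_le_strand_code.
pose S := cell act sd V E.
pose good (A : {fset G}) := `[< folner K eps A /\ (n < #|` A|)%N >].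
have S_good y : V y -> good (S y).
  move=> Vy; apply/asboolP; apply: (LP (fun p => V (act p y))).
    by move=> g; exact: cellP.
  move=> p Vp p1; rewrite ltnNge -mem_height_ball; apply/negP => pL.
  exact: (U0P p y pL p1 (VU0 _ Vy) (VU0 _ Vp)).
have S_sub y g : g \in cell act sd V E y -> g \in E.
  by move=> /mem_cell; exact: nE.
have [W WP] := cell_local sd act_homeo V E.
have /choice[Q QP] x : exists Q : set X, [/\ open Q, Q x,
  closed_null act (boundary Q) &
    forall s y, s \in E -> Q y -> mdist (act s x) (act s y) < eps / 3].
  have e30 : 0 < eps / 3 by rewrite divr_gt0.
  have : nbhs x [set y | forall s, s \in E ->
    mdist (act s x) (act s y) < eps / 3].
    apply: fset_near => s _.
    have cs : {for x, continuous (act s)} by exact: act_continuous.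
    by have := cs _ (nbhsx_ballx (act s x) _ e30); rewrite ballEmdist.
  rewrite nbhsE => -[U [oU Ux] UP].
  have [Q [oQ Qx QU Qnull]] := sbp oU Ux.
  exists Q; split=> //; first by split; [exact: closed_boundary|].
  by move=> s y sE /QU/UP; apply.
have [DQ DQP] : exists DQ : {fset X},
    forall y, exists2 q, q \in DQ & Q q y.
  apply: finite_subcover => // [q|y]; first by case: (QP q).
  by exists y; case: (QP y).
pose tQ y : {fset X} := [fset q in DQ | `[< Q q y >]]%fset.
pose FA : {fset {fset G}} := [fset A in fpowerset E | good A]%fset.
have FAP A : (A \in FA) = (A `<=` E)%fset && good A by rewrite !inE fpowersetE.
(* the index records the cell of a base point and the pieces of the cover
   that contain it *)
pose I : finType := (FA * fpowerset DQ)%type.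
pose shape (i : I) : {fset G} := val i.1.
pose pre (i : I) : set X := [set y | [/\ V y, S y = val i.1 & tQ y = val i.2]].
pose base (i : I) : set X := (pre i)°.
have base_sub i y : base i y -> [/\ V y, S y = val i.1 & tQ y = val i.2].
  by move=> /interior_subset.
have shape_good i : folner K eps (shape i) /\ (n < #|` shape i|)%N.
  by have := fsvalP i.1; rewrite FAP => /andP[_ /asboolP].
have shapeE i g : g \in shape i -> g \in E.
  by have := fsvalP i.1; rewrite FAP => /andP[/fsubsetP sub _]; exact: sub.
have key i j s t y y' : s \in shape i -> t \in shape j ->
    base i y -> base j y' -> act s y = act t y' -> [/\ i = j, s = t & y = y'].
  move=> si tj /base_sub[_ Sy Ty] /base_sub[_ Sy' Ty'] e.
  have sS : s \in cell act sd V E y by rewrite -/S Sy.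
  have tS : t \in cell act sd V E y' by rewrite -/S Sy'.
  have [st yy] := cell_disjoint act_homeo sS tS e.
  split=> //; subst y'; move: Sy Ty Sy' Ty'.
  case: (i) => i1 i2; case: (j) => j1 j2 /=.
  by move=> -> -> /val_inj -> /val_inj ->.
have ocastle : open_castle act shape base.
  split; last by move=> i; exact: open_interior.
  split.
    move=> i s t si ti [_ [[y By <-] [y' By' e]]].
    by have [] := key _ _ _ _ _ _ si ti By By' (esym e).
  move=> i j s t ij si tj; rewrite -subset0 => _ [[y By <-] [y' By' e]].
  have [ij' _ _] := key _ _ _ _ _ _ si tj By By' (esym e).
  by move: ij; rewrite ij' eqxx.
have olevels : open (levels act shape base).
  by apply: open_levels => i; exact: open_interior.
pose C := ~` levels act shape base.
have cC : closed C by exact: open_closedC.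
have nullC : invariant_null act C.
  pose E1 := [fset (w * h^-1)%g | w in W, h in E]%fset.
  pose E2 := [fset (h^-1)%g | h in E]%fset.
  pose Z := \bigcup_(e in [set` (E1 `|` E2)%fset]) (act e @^-1` boundary V `|`
    \bigcup_(q in [set` DQ]) (act e @^-1` boundary (Q q))).
  have closed_nullZ : closed_null act Z.
    apply: closed_null_bigcup => e _; apply: closed_nullU; first
      exact: closed_null_preimage.
    apply: closed_null_bigcup => q _; apply: closed_null_preimage => //.
    by case: (QP q).
  suff CZ : C `<=` Z by have [] := closed_null_sub cC CZ closed_nullZ.
  move=> x Cx; apply: contrapT => nZ; apply: Cx.
  (* off the bad translates, the base point of x lies in an open base *)
  have [h nh] := nearest_exists sd act_min oV V0 x.
  have hE : h \in E by exact: nE nh.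
  pose y := act h^-1%g x.
  have xE : x = act h y by rewrite /y (actKV act_homeo).
  have Vy : V y by case: nh.
  have hS : h \in S y by apply: nearest_in_cell => //; rewrite -xE.
  have nZV w : w \in W -> ~ boundary V (act w y).
    move=> wW b; apply: nZ; exists (w * h^-1)%g; last by left; rewrite /= actM.
    by rewrite /= inE; apply/orP; left; exact: in_imfset2.
  have nZQ q : q \in DQ -> ~ boundary (Q q) (act 1%g y).
    move=> qD b; apply: nZ; exists h^-1%g; last first.
      by right; exists q => //=; rewrite act1 in b.
    by rewrite /= inE; apply/orP; right; apply: in_imfset.
  have SyFA : S y \in FA.
    rewrite FAP S_good // andbT; apply/fsubsetP => g.
    exact: S_sub.
  have tQF : tQ y \in fpowerset DQ.
    by rewrite fpowersetE; apply/fsubsetP => q; rewrite !inE => /andP[].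
  pose i : I := ([` SyFA]%fset, [` tQF]%fset).
  exists i => //; exists h => //; exists y => //.
  have H1 : \forall y' \near y,
      forall w, w \in W -> V (act w y') <-> V (act w y).
    apply: fset_near => w wW; exact: (near_off_boundary act_homeo (nZV w wW)).
  have H2 : \forall y' \near y,
      forall q, q \in DQ -> Q q (act 1%g y') <-> Q q (act 1%g y).
    apply: fset_near => q qD; exact: (near_off_boundary act_homeo (nZQ q qD)).
  have H3 : nbhs y V by apply: open_nbhs_nbhs.
  apply: filterS (filterI (filterI H1 H2) H3) => y' [[h1 h2] Vy'].
  split=> //=; first exact: WP.
  apply/fsetP => q; rewrite !inE; case qD : (q \in DQ) => //=.
  by apply/asboolP/asboolP => Hq; have := h2 q qD; rewrite !act1 // => -[];
    tauto.
exists I, shape, base; split=> //.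
move=> i s si.
  apply: le_lt_trans (_ : _ <= (2 * (eps / 3))%:E)%E _; last first.
    by rewrite lte_fin; lra.
  apply: ge_ereal_sup => _ [[_ _] /= [[y By <-] [y' By' <-]] <-].
  have [_ _ Ty] := base_sub _ _ By; have [_ _ Ty'] := base_sub _ _ By'.
  have [q qD Qy] := DQP y.
  have qT : q \in tQ y by rewrite !inE qD /=; apply/asboolP.
  have Qy' : Q q y'.
    by move: qT; rewrite Ty -Ty' !inE => /andP[_ /asboolP].
  have [_ _ _ Hq] := QP q.
  have l1 := Hq s y (shapeE _ _ si) Qy; have l2 := Hq s y' (shapeE _ _ si) Qy'.
  rewrite lee_fin; apply: le_trans (metric_triangle _ (act s q) _) _.
  by rewrite metric_sym; lra.
Qed.

End castle_construction.

(** * Almost finiteness *)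

Theorem theoremB (R : realType) (G : groupType) (X : pmetricType R)
    (act : G -> X -> X) :
  virtually_Z G ->
  compact [set: X] ->
  infinite_set [set: X] ->
  action_by_homeo act ->
  minimal_action act ->
  topologically_free act ->
  small_boundary_property act ->
  almost_finite act.
Proof.
move=> vZ X_compact X_inf act_homeo act_min act_free sbp K n eps n1 eps0.
have [sd] := strands_exist vZ.
have [I [S [B [ocastle SP dB nullC]]]] :=
  castle_null_remainder sd X_compact act_homeo act_min act_free sbp K n eps0.
have oB i : open (B i) by case: ocastle.
have olevels T : open (levels act T B) by exact: open_levels.
set C := ~` levels act S B in nullC.
have cC : closed C by exact: open_closedC.
exists I, S, B; split=> //; first by move=> i; case: (SP i).
(* one element of each shape suffices, the shapes having more than n
   elements *)
pose head i := nth 1%g (S i) 0.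
have head_in i : head i \in S i.
  by apply: mem_nth; have [_] := SP i; exact: leq_ltn_trans.
exists (fun i => [fset head i]%fset); split.
  move=> i; split; first by rewrite fsub1set.
  rewrite cardfs1; have [_ lt] := SP i.
  by rewrite ltr_pdivlMl ?ltr0n // mulr1 ltr_nat.
apply: null_subequiv => //; apply: contrapT => none.
(* empty levels would make the whole space null, although every average of
   the constant function 1 is 1 *)
have CT : C = setT.
  apply/seteqP; split=> // x _ [i _ [s si [y By yx]]]; apply: none.
  exists (act (head i) y); exists i => //.
  by exists (head i); [rewrite /= inE|exists y].
have h20 : 0 < 2^-1 :> R by rewrite invr_gt0.
have [k [w [k0 _ _ _ [w1 wk]]]] :=
  invariant_null_average sd X_compact act_homeo cC nullC h20 (isT : (0 < 1)%N).
have := wk point; rewrite /birkhoff (eq_bigr (fun=> 1)) => [|j _]; last first.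
  by apply: w1; rewrite CT.
rewrite sumr_const card_ord; have : 0 < k%:R :> R by rewrite ltr0n.
lra.
Qed.
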